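(* Let $f\colon M^n(0)\to\mathbb{R}^{2n}=\mathbb{C}^n$ be a Lagrangian isometric immersion of a flat Riemannian manifold with index of relative nullity $\nu_f\equiv0$. Let $(u_1,\ldots,u_n)$ be principal coordinates on an open subset $U\subset M^n(0)$ and $v_1,\ldots,v_n$ positive functions such that $ds^2=\sum_jv_j^2du_j^2$ and $\alpha(\partial_i,\partial_j)=\delta_{ij}Jf_*\partial_i$, and let $(v,h)$ be the associated solution of the system $$\partial_jv_i=h_{ji}v_j\ (i\neq j),\qquad\Bigl(\sum_{\ell=1}^n\partial_\ell\Bigr)h_{ij}=0\ (i\ne j),\qquad\partial_\ell h_{ij}=h_{i\ell}h_{j\ell}\ (\ell\neq i\neq j\neq\ell),\tag{1}$$ where $v=(v_1,\ldots,v_n)$, $h=(h_{ij})$, $h_{ij}=h_{ji}=v_i^{-1}\partial_iv_j$. Let $P$ be an endomorphism of a Euclidean vector space $V$ such that $\sigma(P)\cap(-\sigma(P))=\emptyset$, and let $(\varphi,\gamma_1,\ldots,\gamma_n)$ be a $V$-valued solution of the linear system of PDEs $$\partial_i\varphi=v_i\gamma_i,\qquad\partial_i\gamma_i=-(P^t)^{-1}\gamma_i-\sum_{j\neq i}h_{ij}\gamma_j,\qquad\partial_i\gamma_j=h_{ij}\gamma_i,\ j\neq i,$$ on an open subset $W\subset U$ where $$\tilde v_i=v_i+\langle\gamma_i,(P+P^{-1})\Omega^{-1}\varphi\rangle$$ does not vanish for all $1\le i\le n$, where $\Omega$ is assumed invertible on $W$ and $\Omega^t=Y$ is the unique solution of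 $P^tY+YP=((P^t)^2+I)\,d\varphi\,(d\varphi)^tP$. Then $\tilde f\colon W\to\mathbb{R}^{2n}=\mathbb{C}^n$ given by $$\tilde f=f-\sum_{j=1}^n\bigl(\langle\Omega^{-1}\varphi,\gamma_j\rangle+\langle P\Omega^{-1}\varphi,\gamma_j\rangle\,i\bigr)f_*X_j,\qquad X_j=v_j^{-1}\partial_j,$$ defines a new Lagrangian isometric immersion with flat induced metric. Moreover, the pair associated to $\tilde f$ is $(\tilde v,\tilde h)$, where $$\tilde h_{ij}=h_{ij}+\langle\gamma_j,(P+P^{-1})\Omega^{-1}\gamma_i\rangle.$$ In particular, $(\tilde v,\tilde h)$ is a new solution of (1).
   Context: An isometric immersion $f\colon M^n\to\mathbb{C}^n$ is Lagrangian if the complex structure $J$ (multiplication by $i$) carries each tangent space of $M^n$ onto the corresponding normal space. $\nu_f(x)$ is the dimension of the kernel of the second fundamental form $\alpha$ at $x$. $\partial_i=\partial/\partial u_i$. For such $f$, principal coordinates as in the claim exist locally. $\sigma(P)$ is the set of complex eigenvalues of $P$; superscript $t$ denotes transpose; $(d\varphi)^t(v)$ is the tangent vector with $\langle(d\varphi)^t(v),X\rangle=\langle v,d\varphi(X)\rangle$, so $d\varphi(d\varphi)^t$ is an endomorphism of $V$ at each point. Since $\sigma(P)\cap(-\sigma(P))=\emptyset$, the equation $P^tY+YP=C$ has a unique solution $Y$ for each endomorphism $C$ of $V$, namely $Y=(q(P^t))^{-1}\sum_{\ell=1}^ka_\ell\sum_{r=0}^{\ell-1}(-1)^r(P^t)^{\ell-1-r}CP^r$,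 where $q(x)=\sum_{\ell=0}^ka_\ell x^\ell$, $a_k=1$, is the characteristic polynomial of $-P$. The pair associated to $\tilde f$ is taken with respect to the same coordinates $u_1,\ldots,u_n$. *)

(* Defs.v *)
(* Everything is written in the chart (u_1, ..., u_n): the coordinate domain is
   an open set U of 'rV[R]_n, tensor fields are given by their components in
   the coordinate frame.  C^n = R^2n is 'rV[R]_(n + n), where row_mx x y
   stands for x + i y.  The Euclidean space V is 'cV[R]_d, its endomorphisms
   are matrices acting on columns, so that composition is *m and the adjoint
   is the transpose. *)
From HB Require Import structures.
From mathcomp Require Import all_boot all_order all_algebra.
From mathcomp Require Import complex.
From mathcomp Require Import boolp classical_sets reals topology normedtype.
From mathcomp Require Import derive.
Set Implicit Arguments.
Unset Strict Implicit.
Unset Printing Implicit Defensive.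
Import Order.TTheory GRing.Theory Num.Theory numFieldNormedType.Exports.
Local Open Scope ring_scope.
Local Open Scope classical_set_scope.

Definition partial (R : realType) (n : nat) (E : normedModType R) (i : 'I_n)
    (F : 'rV[R]_n -> E) : 'rV[R]_n -> E :=
  fun x => 'D_(delta_mx 0 i) F x.

Fixpoint Ck (R : realType) (n : nat) (E : normedModType R) (U : set 'rV[R]_n)
    (k : nat) (F : 'rV[R]_n -> E) : Prop :=
  match k with
  | 0%N => forall x, U x -> {for x, continuous F}
  | k'.+1 => (forall x, U x -> differentiable F x) /\
             (forall i, Ck U k' (partial i F))
  end.

Definition smooth (R : realType) (n : nat) (E : normedModType R)
    (U : set 'rV[R]_n) (F : 'rV[R]_n -> E) : Prop :=
  forall k, Ck U k F.

(* Riemannian metrics: g x is the matrix of <d_i, d_j> at x. *)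

Definition riemannian_metric (R : realType) (n : nat) (U : set 'rV[R]_n)
    (g : 'rV[R]_n -> 'M[R]_n) : Prop :=
  smooth U g /\
  forall x, U x ->
    (g x)^T = g x /\
    forall w : 'rV[R]_n, w != 0 -> 0 < (w *m g x *m w^T) 0 0.

(* Gamma^k_ij of the Levi-Civita connection *)
Definition christoffel (R : realType) (n : nat) (g : 'rV[R]_n -> 'M[R]_n)
    (k i j : 'I_n) (x : 'rV[R]_n) : R :=
  2^-1 * \sum_l invmx (g x) k l *
    (partial i (fun y => g y j l) x + partial j (fun y => g y i l) x
     - partial l (fun y => g y i j) x).

(* component along d_l of R(d_i, d_j) d_k *)
Definition curvature (R : realType) (n : nat) (g : 'rV[R]_n -> 'M[R]_n)
    (l k i j : 'I_n) (x : 'rV[R]_n) : R :=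
  partial i (christoffel g l j k) x - partial j (christoffel g l i k) x
  + \sum_m (christoffel g l i m x * christoffel g m j k x
            - christoffel g l j m x * christoffel g m i k x).

Definition flat (R : realType) (n : nat) (U : set 'rV[R]_n)
    (g : 'rV[R]_n -> 'M[R]_n) : Prop :=
  forall l k i j x, U x -> curvature g l k i j x = 0.

(* The rows of jacobian f x are the vectors f_* d_i. *)

Definition induced_metric (R : realType) (n m : nat)
    (f : 'rV[R]_n -> 'rV[R]_m) (x : 'rV[R]_n) : 'M[R]_n :=
  jacobian f x *m (jacobian f x)^T.

Definition immersion (R : realType) (n m : nat) (U : set 'rV[R]_n)
    (f : 'rV[R]_n -> 'rV[R]_m) : Prop :=
  smooth U f /\ forall x, U x -> row_free (jacobian f x).

Definition isometric_immersion (R : realType) (n m : nat) (U : set 'rV[R]_n)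
    (g : 'rV[R]_n -> 'M[R]_n) (f : 'rV[R]_n -> 'rV[R]_m) : Prop :=
  [/\ riemannian_metric U g,
      immersion U f
    & forall x, U x -> induced_metric f x = g x].

(* The row space is the orthogonal complement of the row space of
   jacobian f x. *)
Definition normal_space (R : realType) (n m : nat)
    (f : 'rV[R]_n -> 'rV[R]_m) (x : 'rV[R]_n) : 'M[R]_m :=
  kermx (jacobian f x)^T.

(* alpha(d_i, d_j): normal component of the Euclidean derivative
   d_i (f_* d_j) *)
Definition second_ff (R : realType) (n m : nat) (f : 'rV[R]_n -> 'rV[R]_m)
    (i j : 'I_n) (x : 'rV[R]_n) : 'rV[R]_m :=
  partial i (partial j f) x
    *m proj_mx (normal_space f x) (<<jacobian f x>>)%MS.

(* Row i of the matrix encodes alpha(d_i, .), so the left kernel consists of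
   the components of the X with alpha(X, .) = 0. *)
Definition relative_nullity (R : realType) (n m : nat)
    (f : 'rV[R]_n -> 'rV[R]_m) (x : 'rV[R]_n) : nat :=
  \rank (kermx (\matrix_(i < n) mxvec (\matrix_(j < n) second_ff f i j x))).

(* w *m Jmx R n is i w: (row_mx x y) *m Jmx R n = row_mx (- y) x. *)
Definition Jmx (R : realType) (n : nat) : 'M[R]_(n + n) :=
  block_mx 0 1%:M (- 1%:M) 0.

Definition cscale (R : realType) (n : nat) (z : R[i]) (w : 'rV[R]_(n + n)) :
    'rV[R]_(n + n) :=
  complex.Re z *: w + complex.Im z *: (w *m Jmx R n).

Definition lagrangian (R : realType) (n : nat) (U : set 'rV[R]_n)
    (f : 'rV[R]_n -> 'rV[R]_(n + n)) : Prop :=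
  forall x, U x -> (jacobian f x *m Jmx R n == normal_space f x)%MS.

(* The v_i are only required to be nonvanishing: this is what is available for
   the transformed pair.  The diagonal entries of h play no role. *)
Definition associated_pair (R : realType) (n : nat) (U : set 'rV[R]_n)
    (g : 'rV[R]_n -> 'M[R]_n) (f : 'rV[R]_n -> 'rV[R]_(n + n))
    (v : 'I_n -> 'rV[R]_n -> R) (h : 'I_n -> 'I_n -> 'rV[R]_n -> R) : Prop :=
  [/\ forall i, smooth U (v i)
        /\ forall x, U x -> v i x != 0,
      forall x, U x -> g x = diag_mx (\row_j v j x ^+ 2),
      forall i j x, U x ->
        second_ff f i j x = (i == j)%:R *: (partial i f x *m Jmx R n)
    & forall i j x, U x -> i != j ->
        h i j x = h j i x /\
        h i j x = (v i x)^-1 * partial i (v j) x].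

Definition solves_system (R : realType) (n : nat) (U : set 'rV[R]_n)
    (v : 'I_n -> 'rV[R]_n -> R) (h : 'I_n -> 'I_n -> 'rV[R]_n -> R) : Prop :=
  [/\ (forall i, smooth U (v i)) /\
      (forall i j, i != j -> smooth U (h i j)),
      forall i j x, U x -> i != j ->
        partial j (v i) x = h j i x * v j x,
      forall i j x, U x -> i != j ->
        \sum_l partial l (h i j) x = 0
    & forall i j l x, U x -> l != i -> i != j -> j != l ->
        partial l (h i j) x = h i l x * h j l x].

(* The set of complex eigenvalues.  eigenvalue is about row vectors, the
   transpose makes it about P acting on columns. *)
Definition spectrum (R : realType) (d : nat) (P : 'M[R]_d) : set R[i] :=
  [set a | eigenvalue (map_mx (real_complex R) P)^T a].

Definition inner (R : realType) (d : nat) (a b : 'cV[R]_d) : R :=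
  \sum_(k < d) a k 0 * b k 0.

Definition diff_mx (R : realType) (n d : nat) (phi : 'rV[R]_n -> 'cV[R]_d)
    (x : 'rV[R]_n) : 'M[R]_(d, n) :=
  \matrix_(k, i) ('d phi x (delta_mx 0 i) : 'cV[R]_d) k 0.

(* Matrix of (d phi)^t, the adjoint with respect to g and the inner product
   of V: with D = diff_mx phi x, the condition (g b)^T X = (D^T a)^T X for all
   X, where b is the column of components of (d phi)^t a, gives
   b = g^-1 D^T a. *)
Definition adj_diff_mx (R : realType) (n d : nat) (g : 'rV[R]_n -> 'M[R]_n)
    (phi : 'rV[R]_n -> 'cV[R]_d) (x : 'rV[R]_n) : 'M[R]_(n, d) :=
  invmx (g x) *m (diff_mx phi x)^T.

Definition solves_linear_system (R : realType) (n d : nat)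
    (W : set 'rV[R]_n) (v : 'I_n -> 'rV[R]_n -> R)
    (h : 'I_n -> 'I_n -> 'rV[R]_n -> R) (P : 'M[R]_d)
    (phi : 'rV[R]_n -> 'cV[R]_d) (gamma : 'I_n -> 'rV[R]_n -> 'cV[R]_d) :
    Prop :=
  [/\ smooth W phi /\ (forall i, smooth W (gamma i)),
      forall i x, W x -> partial i phi x = v i x *: gamma i x,
      forall i x, W x ->
        partial i (gamma i) x =
        - (invmx P^T *m gamma i x) - \sum_(j | j != i) h i j x *: gamma j x
    & forall i j x, W x -> j != i ->
        partial i (gamma j) x = h i j x *: gamma i x].

(* f_* X_j with X_j = v_j^-1 d_j *)
Definition frame (R : realType) (n m : nat) (f : 'rV[R]_n -> 'rV[R]_m)
    (v : 'I_n -> 'rV[R]_n -> R) (j : 'I_n) (x : 'rV[R]_n) : 'rV[R]_m :=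
  (v j x)^-1 *: partial j f x.

Definition transform_v (R : realType) (n d : nat) (v : 'I_n -> 'rV[R]_n -> R)
    (P : 'M[R]_d) (phi : 'rV[R]_n -> 'cV[R]_d)
    (gamma : 'I_n -> 'rV[R]_n -> 'cV[R]_d) (Omega : 'rV[R]_n -> 'M[R]_d)
    (i : 'I_n) (x : 'rV[R]_n) : R :=
  v i x + inner (gamma i x)
                ((P + invmx P) *m (invmx (Omega x) *m phi x)).

Definition transform_h (R : realType) (n d : nat)
    (h : 'I_n -> 'I_n -> 'rV[R]_n -> R) (P : 'M[R]_d)
    (gamma : 'I_n -> 'rV[R]_n -> 'cV[R]_d) (Omega : 'rV[R]_n -> 'M[R]_d)
    (i j : 'I_n) (x : 'rV[R]_n) : R :=
  h i j x + inner (gamma j x)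
                  ((P + invmx P) *m (invmx (Omega x) *m gamma i x)).

Definition transform_f (R : realType) (n d : nat)
    (f : 'rV[R]_n -> 'rV[R]_(n + n)) (v : 'I_n -> 'rV[R]_n -> R)
    (P : 'M[R]_d) (phi : 'rV[R]_n -> 'cV[R]_d)
    (gamma : 'I_n -> 'rV[R]_n -> 'cV[R]_d) (Omega : 'rV[R]_n -> 'M[R]_d)
    (x : 'rV[R]_n) : 'rV[R]_(n + n) :=
  f x - \sum_j
    cscale (inner (invmx (Omega x) *m phi x) (gamma j x)
            +i* inner (P *m (invmx (Omega x) *m phi x)) (gamma j x))%C
           (frame f v j x).

(* Main.v *)
Require Import Defs.
From HB Require Import structures.
From mathcomp Require Import all_boot all_order all_algebra.
From mathcomp Require Import complex.
From mathcomp Require Import boolp classical_sets functions reals topology.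
From mathcomp Require Import landau normedtype.
From mathcomp Require Import derive.
From mathcomp Require Import ring lra.
Set Implicit Arguments.
Unset Strict Implicit.
Unset Printing Implicit Defensive.
Import Order.TTheory GRing.Theory Num.Theory numFieldNormedType.Exports.
Local Open Scope ring_scope.
Local Open Scope classical_set_scope.

(** Let E be the matrix whose rows are the unit vectors E_j = f_* X_j, T the
    matrix with rows gamma_j^t, e_i the i-th unit row, D_i = e_i^t e_i, H the
    symmetric matrix (h_ij) and omega_i = H D_i - D_i H.  Write J for the
    complex structure acting on rows.  The hypotheses on f and the linear
    system for (phi, gamma) become one and the same kind of equation:
<<
      d_i f     = v_i e_i E,     d_i E = omega_i E + D_i E J,
      d_i phi^t = v_i e_i T,     d_i T = omega_i T - D_i T P^-1,
>>
    where E is a unitary frame: E E^t = 1 and E J E^t = 0.  The equation for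
    d_i E holds because the normal part of d_i E_j is prescribed by the second
    fundamental form, while Koszul's argument (the derivatives are metric, and
    mixed partial derivatives of f commute) determines the tangential part
    ([pair_lagrangian_frame]).

    Since omega_i is antisymmetric, it cancels in the derivatives of T^t T and
    of T^t E.  The Sylvester operator L(X) = P^t X + X P is injective by the
    hypothesis on the spectrum, so differentiating L(Omega^t) =
    ((P^t)^2 + 1) T^t T P gives d_i Omega = - T^t D_i T (P + P^-1).  Hence the
    dressing matrix S = (P + P^-1) Omega^-1 satisfies
    d_i S = S T^t D_i T S, and a direct computation shows that
<<
      E' = E - T Omega^-t (T^t E + P^t T^t E J),
      v' = v + phi^t S T^t,          H' = H + T S T^t,
      f' = f - phi^t Omega^-t (T^t E + P^t T^t E J)
>>
    satisfy the same equations as E, v, H, f.  What the computation needs is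
    that S is symmetric, that Omega + Omega^t and P^t Omega - Omega^t P have
    their expected expressions in T^t T, and the value of S T^t T S; all of this
    follows from the equation for Omega, by applying L to both sides.  The
    expressions of the sum and of the difference make E' unitary; the symmetry
    of S and the value of S T^t T S close the equation for d_i E' and yield
    sum_l d_l h'_ij = 0 ([transform_lagrangian_frame],
    [transform_frame_system]).

    Conversely a unitary frame with d_i f' = v'_i e_i E' and
    d_i E' = omega'_i E' + D_i E' J exhibits f' as a Lagrangian immersion with
    metric diag(v'^2) and the required second fundamental form.  The
    Christoffel symbols of such a metric are those of the connection omega'
    read in the coordinate frame; its structure equations are the equations
    for h', and the remaining terms of the curvature cancel because the mixed
    partial derivatives of v' commute ([lagrangian_frame_flat]). *)

(** * Smooth functions on an open set *)

(** Differentiability is a local property; this is the case of the zero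
    function, from which the general one follows by subtraction. *)
Lemma diff_near0 {R : numFieldType} (V W : normedModType R) (H : V -> W) x :
  (\forall y \near x, H y = 0) -> differentiable H x.
Proof.
move=> H0; have Hx : H x = 0 := nbhs_singleton H0.
have H1 : \forall y \near 0, H (y + x) = 0.
  by move: H0; rewrite (near_shift 0 x) /= subr0.
have c0 : continuous (0 : V -> W) by move=> ?; exact: cst_continuous.
have e0 : H \o shift x = cst (H x) + (0 : V -> W) +o_ 0 id.
  apply/eqaddoP => e e0; near=> y.
  rewrite !fctE /= Hx addr0 subr0.
  have -> : H (y + x) = 0 by near: y.
  by rewrite normr0 mulr_ge0 // ltW.
have d0 := @diff_unique _ _ _ H \0 x c0 e0.
apply/diff_locallyP; split; first by rewrite d0.
by rewrite d0.
Unshelve. all: by end_near. Qed.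

Section SmoothCalculus.
Context {R : realType} {n : nat}.
Implicit Types (U : set 'rV[R]_n) (E : normedModType R).

Lemma near_open U x (Q : 'rV[R]_n -> Prop) :
  open U -> U x -> (forall y, U y -> Q y) -> \forall y \near x, Q y.
Proof. by move=> oU Ux UQ; apply: filterS UQ _; apply: open_nbhs_nbhs. Qed.

Lemma eq_partial U E i (F G : 'rV[R]_n -> E) x :
  open U -> (forall y, U y -> F y = G y) -> U x -> partial i F x = partial i G x.
Proof.
move=> oU FG Ux; apply: near_eq_derive.
exact: (@near_open U x (fun y => F y = G y)) oU Ux FG.
Qed.

Lemma eq_differentiable U E (F G : 'rV[R]_n -> E) x :
  open U -> (forall y, U y -> F y = G y) -> U x ->
  differentiable F x -> differentiable G x.
Proof.
move=> oU FG Ux dF; rewrite (_ : G = F + (G - F)); last by rewrite addrC subrK.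
apply: differentiableD => //; apply: diff_near0.
apply: (@near_open U x (fun y => (G - F) y = 0)) oU Ux _ => y Uy.
by rewrite !fctE FG // subrr.
Qed.

(** Functions given by a formula on [U] only, such as [Omega], are replaced by
    that formula with this lemma; openness matters because each partial
    derivative must again agree on [U]. *)
Lemma eq_Ck U E k (F G : 'rV[R]_n -> E) :
  open U -> (forall y, U y -> F y = G y) -> Ck U k F -> Ck U k G.
Proof.
move=> oU; elim: k F G => [|k IH] F G FG /=.
  move=> cF x Ux.
  have e : {near x, F =1 G} by exact: (@near_open U x (fun y => F y = G y)).
  have := cF x Ux; rewrite /prop_for /continuous_at -(FG x Ux).
  exact: cvg_trans (near_eq_cvg e).
case=> dF cF; split=> [x Ux|i]; first exact: eq_differentiable FG Ux (dF x Ux).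
by apply: IH (cF i) => y Uy; apply: eq_partial FG Uy.
Qed.

Lemma eq_smooth U E (F G : 'rV[R]_n -> E) :
  open U -> (forall y, U y -> F y = G y) -> smooth U F -> smooth U G.
Proof. by move=> oU FG sF k; apply: eq_Ck FG (sF k). Qed.

Lemma CkS U E k (F : 'rV[R]_n -> E) : Ck U k.+1 F -> Ck U k F.
Proof.
elim: k F => [|k IH] F /=; first by case=> dF _ x /dF/differentiable_continuous.
by case=> dF cF; split=> // i; apply: IH.
Qed.

Lemma smooth_diff U E (F : 'rV[R]_n -> E) x :
  smooth U F -> U x -> differentiable F x.
Proof. by move=> /(_ 1%N)[dF _] /dF. Qed.

Lemma smooth_partial U E i (F : 'rV[R]_n -> E) :
  smooth U F -> smooth U (partial i F).
Proof. by move=> sF k; have [_ cF] := sF k.+1; apply: cF. Qed.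

Lemma subset_smooth U U' E (F : 'rV[R]_n -> E) :
  U' `<=` U -> smooth U F -> smooth U' F.
Proof.
move=> sUU sF k; move: (sF k); clear sF.
elim: k F => [|k IH] F /=; first by move=> cF x /sUU/cF.
by case=> dF cF; split=> [x /sUU/dF|i] //; apply: IH.
Qed.

Lemma smooth_cst U E (a : E) : smooth U (fun=> a).
Proof.
move=> k; elim: k a => [|k IH] a /=; first by move=> x _; exact: cst_continuous.
split=> [x _|i]; first exact: differentiable_cst.
by rewrite (_ : partial i _ = fun=> 0) // funeqE => x; apply: derive_cst.
Qed.

Lemma CkD U E k (F G : 'rV[R]_n -> E) : open U ->
  Ck U k F -> Ck U k G -> Ck U k (fun x => F x + G x).
Proof.
move=> oU; elim: k F G => [|k IH] F G /=.
  by move=> cF cG x Ux; exact: (continuousD (cF x Ux) (cG x Ux)).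
move=> [dF cF] [dG cG]; split=> [x Ux|i].
  exact: differentiableD (dF _ Ux) (dG _ Ux).
apply: eq_Ck (IH _ _ (cF i) (cG i)) => // x Ux.
by rewrite /partial deriveD //; apply: diff_derivable; [apply: dF|apply: dG].
Qed.

Lemma smoothD U E (F G : 'rV[R]_n -> E) : open U ->
  smooth U F -> smooth U G -> smooth U (fun x => F x + G x).
Proof. by move=> oU sF sG k; apply: CkD. Qed.

Lemma CkM U k (F G : 'rV[R]_n -> R) : open U ->
  Ck U k F -> Ck U k G -> Ck U k (fun x => F x * G x).
Proof.
move=> oU; elim: k F G => [|k IH] F G cF cG.
  by move=> x Ux; exact: (continuousM (cF x Ux) (cG x Ux)).
have cF' := CkS cF; have cG' := CkS cG; move: cF cG => [dF cF] [dG cG].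
split=> [x Ux|i]; first exact: differentiableM (dF _ Ux) (dG _ Ux).
apply: eq_Ck (CkD oU (IH _ _ cF' (cG i)) (IH _ _ cG' (cF i))) => // x Ux.
by rewrite /partial deriveM //; apply: diff_derivable; [apply: dF|apply: dG].
Qed.

Lemma smoothM U (F G : 'rV[R]_n -> R) : open U ->
  smooth U F -> smooth U G -> smooth U (fun x => F x * G x).
Proof. by move=> oU sF sG k; apply: CkM. Qed.

Lemma smoothV U (F : 'rV[R]_n -> R) : open U -> (forall x, U x -> F x != 0) ->
  smooth U F -> smooth U (fun x => (F x)^-1).
Proof.
move=> oU F0 sF; elim=> [|k IH] /=.
  by move=> x Ux; exact: (continuousV (F0 x Ux) (sF 0%N x Ux)).
split=> [x Ux|i]; first exact: differentiableV (smooth_diff sF Ux) (F0 _ Ux).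
have cF := smooth_partial i sF k.
apply: eq_Ck (CkM oU (@smooth_cst U R (-1) k) (CkM oU (CkM oU IH IH) cF)) => //.
move=> x Ux; have dF : derivable F x (delta_mx 0 i).
  by apply: diff_derivable; apply: smooth_diff Ux.
by rewrite /partial (deriveV (F0 _ Ux) dF) mulN1r scaleNr -exprVn expr2.
Qed.

Lemma smoothN U E (F : 'rV[R]_n -> E) : open U ->
  smooth U F -> smooth U (fun x => - F x).
Proof.
move=> oU sF k; elim: k F sF => [|k IH] F sF /=.
  by move=> x Ux; exact: (continuousN (sF 0%N x Ux)).
split=> [x Ux|i]; first exact: differentiableN (smooth_diff sF Ux).
apply: eq_Ck (IH _ (smooth_partial i sF)) => // x Ux.
by rewrite /partial deriveN //; apply: diff_derivable; apply: smooth_diff Ux.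
Qed.

Lemma smoothB U E (F G : 'rV[R]_n -> E) : open U ->
  smooth U F -> smooth U G -> smooth U (fun x => F x - G x).
Proof. by move=> oU sF sG; apply: smoothD => //; apply: smoothN. Qed.

Lemma smooth_sum U (I : Type) (r : seq I) (Q : pred I) E
    (F : I -> 'rV[R]_n -> E) : open U ->
  (forall i, Q i -> smooth U (F i)) ->
  smooth U (fun x => \sum_(i <- r | Q i) F i x).
Proof.
move=> oU sF; elim: r => [|i r IH].
  by apply: eq_smooth (@smooth_cst U E 0) => // x _; rewrite big_nil.
case Qi: (Q i).
  apply: eq_smooth (smoothD oU (sF i Qi) IH) => // x _.
  by rewrite big_cons Qi.
by apply: eq_smooth IH => // x _; rewrite big_cons Qi.
Qed.

Lemma smooth_prod U (I : Type) (r : seq I) (Q : pred I)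
    (F : I -> 'rV[R]_n -> R) : open U ->
  (forall i, Q i -> smooth U (F i)) ->
  smooth U (fun x => \prod_(i <- r | Q i) F i x).
Proof.
move=> oU sF; elim: r => [|i r IH].
  by apply: eq_smooth (@smooth_cst U R 1) => // x _; rewrite big_nil.
case Qi: (Q i).
  apply: eq_smooth (smoothM oU (sF i Qi) IH) => // x _.
  by rewrite big_cons Qi.
by apply: eq_smooth IH => // x _; rewrite big_cons Qi.
Qed.

(** With constant vectors [a] ranging over the matrix units this reduces the
    smoothness of a matrix to that of its entries. *)
Lemma smoothZ_cst U E (F : 'rV[R]_n -> R) (a : E) : open U ->
  smooth U F -> smooth U (fun x => F x *: a).
Proof.
move=> oU sF k; elim: k F sF => [|k IH] F sF /=.
  by move=> x Ux; exact: (continuousZr_tmp (sF 0%N x Ux)).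
split=> [x Ux|i]; first exact: differentiableZl (smooth_diff sF Ux).
apply: eq_Ck (IH _ (smooth_partial i sF)) => // x Ux.
have dF := smooth_diff sF Ux.
by rewrite /partial !deriveE ?diffZl //; apply: differentiableZl.
Qed.

Lemma partial_mx p q i (F : 'rV[R]_n -> 'M[R]_(p, q)) x a b :
  differentiable F x ->
  partial i F x a b = partial i (fun y => F y a b) x.
Proof.
by move=> dF; rewrite /partial derive_mx ?mxE //; apply: diff_derivable.
Qed.

Lemma differentiable_entry p q (F : 'rV[R]_n -> 'M[R]_(p, q)) x a b :
  differentiable F x -> differentiable (fun y => F y a b) x.
Proof.
move=> dF; exact: (@differentiable_comp _ _ _ _ F
  (fun N : 'M[R]_(p, q) => N a b : R) x dF (@differentiable_coord _ _ _ _ a b)).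
Qed.

Lemma smooth_entry U p q (F : 'rV[R]_n -> 'M[R]_(p, q)) a b : open U ->
  smooth U F -> smooth U (fun y => F y a b).
Proof.
move=> oU sF k; elim: k F sF => [|k IH] F sF /=.
  move=> x Ux; apply: differentiable_continuous.
  exact: differentiable_entry (smooth_diff sF Ux).
split=> [x Ux|i]; first exact: differentiable_entry (smooth_diff sF Ux).
apply: eq_Ck (IH _ (smooth_partial i sF)) => // x Ux.
by rewrite partial_mx //; apply: smooth_diff Ux.
Qed.

Lemma smooth_mx U p q (F : 'rV[R]_n -> 'M[R]_(p, q)) : open U ->
  (forall a b, smooth U (fun y => F y a b)) -> smooth U F.
Proof.
move=> oU sF.
have sS : smooth U (fun x => \sum_a \sum_b F x a b *: delta_mx a b).
  by do 2!apply: smooth_sum => // ? _; apply: smoothZ_cst.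
by apply: eq_smooth sS => // x _; rewrite -matrix_sum_delta.
Qed.

Lemma smooth_mulmx U p q r (F : 'rV[R]_n -> 'M[R]_(p, q))
    (G : 'rV[R]_n -> 'M[R]_(q, r)) : open U ->
  smooth U F -> smooth U G -> smooth U (fun x => F x *m G x).
Proof.
move=> oU sF sG; apply: smooth_mx => // a b.
have sS : smooth U (fun x => \sum_c F x a c * G x c b).
  by apply: smooth_sum => // c _; apply: smoothM => //; apply: smooth_entry.
by apply: eq_smooth sS => // x _; rewrite mxE.
Qed.

Lemma smooth_trmx U p q (F : 'rV[R]_n -> 'M[R]_(p, q)) : open U ->
  smooth U F -> smooth U (fun x => (F x)^T).
Proof.
move=> oU sF; apply: smooth_mx => // a b.
by apply: eq_smooth (smooth_entry b a oU sF) => // x _; rewrite mxE.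
Qed.

Lemma smooth_det U p (F : 'rV[R]_n -> 'M[R]_p) : open U ->
  (forall a b, smooth U (fun y => F y a b)) -> smooth U (fun x => \det (F x)).
Proof.
move=> oU sF; apply: smooth_sum => // s _.
apply: smoothM => //; first exact: smooth_cst.
by apply: smooth_prod.
Qed.

(** By Cramer's rule: inverse of the determinant times the cofactors. *)
Lemma smooth_invmx U p (F : 'rV[R]_n -> 'M[R]_p) : open U ->
  (forall x, U x -> F x \in unitmx) ->
  smooth U F -> smooth U (fun x => invmx (F x)).
Proof.
move=> oU Fu sF; apply: smooth_mx => // a b.
have sF' c e := smooth_entry c e oU sF.
have sI : smooth U (fun x => (\det (F x))^-1 * cofactor (F x) b a).
  apply: smoothM => //; first apply: smoothV => //.
  - by move=> x /Fu; rewrite unitmxE unitfE.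
  - exact: smooth_det.
  apply: smoothM => //; first exact: smooth_cst.
  apply: smooth_det => // c e.
  by apply: eq_smooth (sF' (lift b c) (lift a e)) => // x _; rewrite !mxE.
by apply: eq_smooth sI => // x Ux; rewrite /invmx Fu // !mxE.
Qed.

End SmoothCalculus.

(** * Schwarz' theorem *)

Section Schwarz.
Context {R : realType} {V : normedModType R}.
Implicit Types (F : V -> R) (x y e f : V).

Lemma is_derive_line F y e (s : R) : differentiable F (s *: e + y) ->
  is_derive s 1 (fun r : R => F (r *: e + y)) ('D_e F (s *: e + y)).
Proof.
move=> dF; have /derivableP := @diff_derivable _ _ _ F (s *: e + y) e dF.
have E : (fun h : R => h^-1 *: (F (h *: e + (s *: e + y)) - F (s *: e + y)))
  = (fun h : R => h^-1 *: (F ((h *: 1 + s) *: e + y) - F (s *: e + y))).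
  by rewrite funeqE => h; rewrite addrA -scalerDl [h *: 1]mulr1.
case=> [cF _]; apply: DeriveDef.
  by move: cF; rewrite /derivable E.
by rewrite /derive E.
Qed.

(** The mean value theorem is used twice: first along [e], for the difference
    of [F] on the two opposite edges parallel to [e], then along [f] for
    ['D_e F]. *)
Lemma second_difference F x e f (t : R) : 0 < t ->
  (forall a b, 0 <= a <= t -> 0 <= b <= t ->
     differentiable F (a *: e + (b *: f + x)) /\
     differentiable ('D_e F) (b *: f + (a *: e + x))) ->
  exists a b, [/\ 0 <= a <= t, 0 <= b <= t &
    F (t *: e + (t *: f + x)) - F (t *: e + x) - (F (t *: f + x) - F x)
    = 'D_f ('D_e F) (b *: f + (a *: e + x)) * t * t].
Proof.
move=> t0 dF; have tt : 0 <= t <= t by rewrite lexx ltW.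
have t00 : 0 <= (0 : R) <= t by rewrite lexx ltW.
have dF0 a : 0 <= a <= t -> differentiable F (a *: e + x).
  by move=> ha; have [] := dF a 0 ha t00; rewrite scale0r add0r.
pose H := fun s : R => F (s *: e + (t *: f + x)) - F (s *: e + x).
pose dH := fun s : R => 'D_e F (s *: e + (t *: f + x)) - 'D_e F (s *: e + x).
have iH s : 0 <= s <= t -> is_derive s 1 H (dH s).
  move=> hs; apply: is_deriveB; apply: is_derive_line; last exact: dF0.
  by have [] := dF s t hs tt.
have cont (G dG : R -> R) : (forall s, 0 <= s <= t -> is_derive s 1 G (dG s)) ->
    exists2 c, 0 <= c <= t & G t - G 0 = dG c * t.
  move=> iG; have [c cin] : exists2 c, c \in `]0, t[%R & G t - G 0 = dG c * (t - 0).
    apply: MVT => // [s|].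
      by rewrite in_itv /= => /andP[/ltW s0 /ltW st]; apply: iG; rewrite s0 st.
    apply: derivable_within_continuous => s.
    by rewrite in_itv /= => /iG [].
  rewrite subr0 => ->; exists c => //.
  by move: cin; rewrite in_itv /= => /andP[/ltW -> /ltW ->].
have [a ha Ha] := cont _ _ iH.
pose K := fun s : R => 'D_e F (s *: f + (a *: e + x)).
have iK s : 0 <= s <= t ->
    is_derive s 1 K ('D_f ('D_e F) (s *: f + (a *: e + x))).
  by move=> hs; apply: is_derive_line; have [] := dF a s ha hs.
have [b hb Hb] := cont _ _ iK.
exists a, b; split=> //.
rewrite -Hb -[RHS]/(_ * t); transitivity (H t - H 0).
  by rewrite /H scale0r !add0r.
by rewrite Ha /dH /K scale0r add0r addrCA.
Qed.

Lemma ball_close2 (W : set V) (p q : V -> R) x (eps : R) : open W -> W x ->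
  {for x, continuous p} -> {for x, continuous q} -> 0 < eps ->
  exists2 r : R, 0 < r & forall y, ball x r y ->
    [/\ W y, `|p x - p y| <= eps & `|q x - q y| <= eps].
Proof.
move=> oW Wx /cvgrPdist_le cp /cvgrPdist_le cq eps0.
have n0 : nbhs x W by apply: open_nbhs_nbhs.
have n1 : nbhs x (W `&` ((fun t : V => `|p x - p t| <= eps) `&`
                         (fun t : V => `|q x - q t| <= eps))).
  by apply: filterI => //; apply: filterI; [apply: cp|apply: cq].
have [r /= r0 br] := (iffLR (nbhs_ballP _ _)) n1.
by exists r => // y /br /= [? [? ?]].
Qed.

Lemma dist_le_halves (a b c d eps : R) : c = d ->
  `|a - c| <= eps / 2 -> `|b - d| <= eps / 2 -> `|a - b| <= eps.
Proof.
move=> <- ac bc; apply: (le_trans (ler_distD c _ _)).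
by rewrite [leRHS]splitr lerD // distrC.
Qed.

(** The second difference of [F] on a small square is t^2 times each of the
    two mixed derivatives, at two points of the square; both points tend to
    [x] with the side of the square, and the mixed derivatives are continuous
    at [x]. *)
Lemma derive_comm (W : set V) F x e f : open W -> W x ->
  (forall y, W y -> [/\ differentiable F y, differentiable ('D_e F) y
     & differentiable ('D_f F) y]) ->
  {for x, continuous ('D_f ('D_e F))} -> {for x, continuous ('D_e ('D_f F))} ->
  'D_f ('D_e F) x = 'D_e ('D_f F) x.
Proof.
move=> oW Wx dF c1 c2; apply/eqP; rewrite -subr_eq0 -normr_le0.
apply/ler_addgt0Pl => eps eps0; rewrite addr0.
have eps2 : 0 < eps / 2 by rewrite divr_gt0.
have [r r0 ballr] := ball_close2 oW Wx c1 c2 eps2.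
(* The side [t] keeps the whole square in the ball; the summand 1 in [N] is
   there in case both directions vanish. *)
pose N := `|e| + `|f| + 1.
have N0 : 0 < N by rewrite ltr_wpDl // addr_ge0.
pose t := r / (N * 2).
have t0 : 0 < t by rewrite divr_gt0 // mulr_gt0.
have inb a b : 0 <= a <= t -> 0 <= b <= t -> ball x r (a *: e + (b *: f + x)).
  move=> /andP[a0 at_] /andP[b0 bt]; rewrite -ball_normE /= addrA.
  rewrite opprD addrCA subrr addr0 normrN.
  apply: (le_lt_trans (ler_normD _ _)); rewrite !normrZ !ger0_norm //.
  apply: (@le_lt_trans _ _ (t * N)).
    rewrite /N !mulrDr mulr1 -[leLHS]addr0.
    have := ler_wpM2r (normr_ge0 e) at_; have := ler_wpM2r (normr_ge0 f) bt.
    by move: t0; lra.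
  have -> : t * N = r / 2 by rewrite /t; field; rewrite gt_eqF.
  by move: r0; lra.
have inb' a b : 0 <= a <= t -> 0 <= b <= t -> ball x r (b *: f + (a *: e + x)).
  by move=> ha hb; rewrite addrCA; apply: inb.
have [|a [b [ha hb E1]]] := @second_difference F x e f t t0.
  move=> a b ha hb.
  have [/dF[d1 _ _] _ _] := ballr _ (inb _ _ ha hb).
  by have [/dF[_ d2 _] _ _] := ballr _ (inb' _ _ ha hb).
have [|b' [a' [hb' ha' E2]]] := @second_difference F x f e t t0.
  move=> b' a' hb' ha'.
  have [/dF[d1 _ _] _ _] := ballr _ (inb' _ _ ha' hb').
  by have [/dF[_ _ d2] _ _] := ballr _ (inb _ _ ha' hb').
have E : 'D_f ('D_e F) (b *: f + (a *: e + x)) =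
         'D_e ('D_f F) (a' *: e + (b' *: f + x)).
  apply: (mulIf (lt0r_neq0 t0)); apply: (mulIf (lt0r_neq0 t0)).
  move: E1; rewrite [t *: e + (t *: f + x)]addrCA => E1.
  apply: etrans (esym E1) (etrans _ E2).
  by rewrite !opprB (addrC (F x)) addrACA (addrC (F x)).
have [_ l1 _] := ballr _ (inb' _ _ ha hb).
have [_ _ l2] := ballr _ (inb _ _ ha' hb').
exact: dist_le_halves E l1 l2.
Qed.
End Schwarz.

(** * Rules for partial derivatives *)

Section HasPartial.
Context {R : realType} {n : nat} (W : set 'rV[R]_n) (oW : open W).
Implicit Types (E : normedModType R) (i : 'I_n).

(** Smoothness is carried along with the value of the derivative, so that the
    rules below compose without differentiability side conditions. *)
Definition has_partial E i (F dF : 'rV[R]_n -> E) : Prop :=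
  smooth W F /\ forall x, W x -> partial i F x = dF x.

Lemma smooth_derivable E i (F : 'rV[R]_n -> E) x :
  smooth W F -> W x -> derivable F x (delta_mx 0 i).
Proof. by move=> sF Wx; apply: diff_derivable; apply: smooth_diff Wx. Qed.

Lemma has_partialT E i (F : 'rV[R]_n -> E) :
  smooth W F -> has_partial i F (partial i F).
Proof. by []. Qed.

Lemma eq_has_partial E i (F dF G dG : 'rV[R]_n -> E) :
  has_partial i F dF -> (forall x, W x -> F x = G x) ->
  (forall x, W x -> dF x = dG x) -> has_partial i G dG.
Proof.
move=> [sF e] FG dFG; split; first exact: eq_smooth FG sF.
by move=> x Wx; rewrite -dFG // -e //; apply/esym; exact: (eq_partial i oW FG Wx).
Qed.

Lemma has_partial_cst E i (a : E) : has_partial i (fun=> a) (fun=> 0).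
Proof. by split; [exact: smooth_cst | move=> x _; exact: derive_cst]. Qed.

Lemma has_partialD E i (F dF G dG : 'rV[R]_n -> E) :
  has_partial i F dF -> has_partial i G dG ->
  has_partial i (fun x => F x + G x) (fun x => dF x + dG x).
Proof.
move=> [sF eF] [sG eG]; split; first exact: smoothD.
by move=> x Wx; rewrite -eF // -eG //; apply: deriveD; apply: smooth_derivable.
Qed.

Lemma has_partialN E i (F dF : 'rV[R]_n -> E) :
  has_partial i F dF -> has_partial i (fun x => - F x) (fun x => - dF x).
Proof.
move=> [sF eF]; split; first exact: smoothN.
by move=> x Wx; rewrite -eF //; apply: deriveN; apply: smooth_derivable.
Qed.

Lemma has_partialB E i (F dF G dG : 'rV[R]_n -> E) :
  has_partial i F dF -> has_partial i G dG ->
  has_partial i (fun x => F x - G x) (fun x => dF x - dG x).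
Proof. by move=> hF hG; apply: has_partialD => //; apply: has_partialN. Qed.

Lemma has_partialM i (F dF G dG : 'rV[R]_n -> R) :
  has_partial i F dF -> has_partial i G dG ->
  has_partial i (fun x => F x * G x) (fun x => dF x * G x + F x * dG x).
Proof.
move=> [sF eF] [sG eG]; split; first exact: smoothM.
move=> x Wx; rewrite -eF // -eG // addrC [_ * G x]mulrC.
by apply: deriveM; apply: smooth_derivable.
Qed.

Lemma has_partialZ i (c : R) (F dF : 'rV[R]_n -> R) :
  has_partial i F dF -> has_partial i (fun x => c * F x) (fun x => c * dF x).
Proof.
move=> hF; have hc := @has_partial_cst R i c.
apply: eq_has_partial (has_partialM hc hF) _ _ => // x _.
by rewrite mul0r add0r.
Qed.

Lemma has_partial_sum E i (I : finType) (F dF : I -> 'rV[R]_n -> E) :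
  (forall j, has_partial i (F j) (dF j)) ->
  has_partial i (fun x => \sum_j F j x) (fun x => \sum_j dF j x).
Proof.
move=> hF; elim: (index_enum I) => [|j r IH].
  apply: eq_has_partial (has_partial_cst i 0) _ _ => x _; by rewrite big_nil.
by apply: eq_has_partial (has_partialD (hF j) IH) _ _ => x _; rewrite big_cons.
Qed.

Lemma has_partial_entry p q i (F dF : 'rV[R]_n -> 'M[R]_(p, q)) a b :
  has_partial i F dF -> has_partial i (fun x => F x a b) (fun x => dF x a b).
Proof.
move=> [sF eF]; split; first exact: smooth_entry.
by move=> x Wx; rewrite -eF // partial_mx //; apply: smooth_diff Wx.
Qed.

Lemma has_partial_mx p q i (F dF : 'rV[R]_n -> 'M[R]_(p, q)) :
  (forall a b, has_partial i (fun x => F x a b) (fun x => dF x a b)) ->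
  has_partial i F dF.
Proof.
move=> hF; have sF : smooth W F by apply: smooth_mx => // a b; case: (hF a b).
split=> // x Wx; apply/matrixP => a b; have [_ <- //] := hF a b.
by rewrite partial_mx //; apply: smooth_diff Wx.
Qed.

Lemma has_partial_mulmx p q r i (F dF : 'rV[R]_n -> 'M[R]_(p, q))
    (G dG : 'rV[R]_n -> 'M[R]_(q, r)) :
  has_partial i F dF -> has_partial i G dG ->
  has_partial i (fun x => F x *m G x) (fun x => dF x *m G x + F x *m dG x).
Proof.
move=> hF hG; apply: has_partial_mx => a b.
have hS := has_partial_sum (fun c => has_partialM (has_partial_entry a c hF)
  (has_partial_entry c b hG)).
by apply: eq_has_partial hS _ _ => x _; rewrite !mxE // big_split.
Qed.

Lemma has_partial_scale p q i (F dF : 'rV[R]_n -> R)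
    (G dG : 'rV[R]_n -> 'M[R]_(p, q)) :
  has_partial i F dF -> has_partial i G dG ->
  has_partial i (fun x => F x *: G x) (fun x => dF x *: G x + F x *: dG x).
Proof.
move=> hF hG; apply: has_partial_mx => a b.
apply: eq_has_partial (has_partialM hF (has_partial_entry a b hG)) _ _ => x _;
  by rewrite !mxE.
Qed.

Lemma has_partial_trmx p q i (F dF : 'rV[R]_n -> 'M[R]_(p, q)) :
  has_partial i F dF -> has_partial i (fun x => (F x)^T) (fun x => (dF x)^T).
Proof.
move=> hF; apply: has_partial_mx => a b.
by apply: eq_has_partial (has_partial_entry b a hF) _ _ => x _; rewrite !mxE.
Qed.

(** Differentiate F F^-1 = 1. *)
Lemma has_partial_invmx p i (F dF : 'rV[R]_n -> 'M[R]_p) :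
  (forall x, W x -> F x \in unitmx) -> has_partial i F dF ->
  has_partial i (fun x => invmx (F x))
    (fun x => - (invmx (F x) *m dF x *m invmx (F x))).
Proof.
move=> uF hF; have sI : smooth W (fun x => invmx (F x)).
  by apply: smooth_invmx => //; case: hF.
split=> // x Wx.
have [_ e1] := has_partial_mulmx hF (has_partialT i sI).
have [_ e0] : has_partial i (fun x => F x *m invmx (F x)) (fun=> 0).
  by apply: eq_has_partial (has_partial_cst i 1%:M) _ _ => // y /uF/mulmxV.
move: (e1 x Wx); rewrite e0 // => /eqP.
rewrite eq_sym addrC addr_eq0 => /eqP /(congr1 (mulmx (invmx (F x)))).
by rewrite mulKmx ?uF // => ->; rewrite mulmxN mulmxA.
Qed.

Lemma partial_comm (F : 'rV[R]_n -> R) i j x : smooth W F -> W x ->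
  partial i (partial j F) x = partial j (partial i F) x.
Proof.
move=> sF Wx; apply: (derive_comm oW) => //.
- move=> y Wy; split; apply: smooth_diff Wy => //; exact: smooth_partial.
- exact: (smooth_partial i (smooth_partial j sF) 0%N).
- exact: (smooth_partial j (smooth_partial i sF) 0%N).
Qed.

Lemma partial_comm_mx p q (F : 'rV[R]_n -> 'M[R]_(p, q)) i j x :
  smooth W F -> W x -> partial i (partial j F) x = partial j (partial i F) x.
Proof.
move=> sF Wx; apply/matrixP => a b.
have sFa := smooth_entry a b oW sF.
have key k l : partial k (partial l F) x a b =
               partial k (partial l (fun y => F y a b)) x.
  rewrite partial_mx; last by apply: smooth_diff Wx; apply: smooth_partial.
  have FG y : W y -> partial l F y a b = partial l (fun z => F z a b) y.
    by move=> Wy; rewrite partial_mx //; apply: smooth_diff Wy.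
  exact: (@eq_partial R n W R k _ _ x oW FG Wx).
apply: etrans (key i j) (etrans _ (esym (key j i))).
exact: partial_comm sFa Wx.
Qed.
End HasPartial.

(** * The Sylvester equation *)

Section Sylvester.

Lemma noteigen_unitmx (F : fieldType) d (A : 'M[F]_d) a :
  ~~ eigenvalue A a -> A - a%:M \in unitmx.
Proof. by rewrite negbK kermx_eq0 row_free_unit. Qed.

(** A Y = Y B implies q(A) Y = Y q(B) for every polynomial q.  For q the
    characteristic polynomial of B the right-hand side vanishes by
    Cayley-Hamilton, while q(A) is the product of the A - a over the
    eigenvalues a of B, each of which is invertible. *)
Lemma sylvester_inj_closed (F : closedFieldType) d (A B Y : 'M[F]_d) :
  (forall a, eigenvalue A a -> ~~ eigenvalue B a) ->
  A *m Y = Y *m B -> Y = 0.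
Proof.
case: d A B Y => [|d] A B Y AB e; first by apply/matrixP => -[].
have [s Es] := closed_field_poly_normal (char_poly B).
have lc : lead_coef (char_poly B) = 1 by apply/eqP; exact: char_poly_monic.
rewrite lc scale1r in Es.
have sB a : a \in s -> A - a%:M \in unitmx.
  move=> sa; apply: noteigen_unitmx; apply/negP => /AB /negP; apply.
  by rewrite eigenvalue_root_char Es root_prod_XsubC.
have CH : \prod_(a <- s) (B - a%:M) = 0.
  rewrite -(Cayley_Hamilton B) Es rmorph_prod; apply: eq_bigr => a _.
  by rewrite rmorphB /= horner_mx_X horner_mx_C.
have : (\prod_(a <- s) (A - a%:M)) *m Y = 0.
  rewrite -[RHS](mulmx0 _ Y) -CH; elim: (s) => [|a r IH].
    by rewrite !big_nil [LHS]mul1mx mulmx1.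
  rewrite !big_cons -[LHS]mulmxA IH !mulmxA; congr (_ *m _).
  by rewrite mulmxBl e mulmxBr scalar_mxC.
elim: s sB {Es CH} => [|a r IH] sB; first by rewrite big_nil [LHS]mul1mx.
rewrite big_cons -[LHS]mulmxA => /(congr1 (mulmx (invmx (A - a%:M)))).
rewrite mulKmx ?sB ?mem_head // mulmx0; apply: IH => b br.
by apply: sB; rewrite inE br orbT.
Qed.

Lemma eigenvalue_trmx (F : fieldType) d (A : 'M[F]_d) a :
  eigenvalue A^T a = eigenvalue A a.
Proof.
rewrite !eigenvalue_root_char; congr (root _ a).
rewrite /char_poly -[in RHS]det_tr; congr (\det _).
by rewrite /char_poly_mx linearB /= tr_scalar_mx map_trmx.
Qed.

Lemma eigenvalueN (F : fieldType) d (A : 'M[F]_d) a :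
  eigenvalue (- A) a = eigenvalue A (- a).
Proof.
apply/eigenvalueP/eigenvalueP => -[w ew w0]; exists w => //.
  by rewrite scaleNr -ew mulmxN opprK.
by rewrite mulmxN ew scaleNr opprK.
Qed.

Context {R : realType} {d : nat} (P : 'M[R]_d).
Hypothesis sP : spectrum P `&` [set - a | a in spectrum P] = set0.

Lemma sylvester_inj (Y : 'M[R]_d) : P^T *m Y + Y *m P = 0 -> Y = 0.
Proof.
move=> /eqP; rewrite addr_eq0 -mulmxN => /eqP /(congr1 (map_mx (real_complex R))).
rewrite !map_mxM => e; apply: (map_mx_inj (f := real_complex R)).
rewrite map_mx0; apply: sylvester_inj_closed e => a.
rewrite -map_trmx map_mxN => ea; apply/negP.
rewrite eigenvalueN -eigenvalue_trmx => ena.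
have sPa : spectrum P a by exact: ea.
have sPNa : spectrum P (- a) by exact: ena.
have : (spectrum P `&` [set - b | b in spectrum P]) a.
  by apply: conj sPa _; exact: ex_intro2 sPNa (opprK a).
by rewrite sP.
Qed.

(** If w P = 0 for a row w, then w^t w is in the kernel of the Sylvester
    operator. *)
Lemma sylvester_unitmx : P \in unitmx.
Proof.
rewrite -row_free_unit -kermx_eq0; apply/eqP/row_matrixP => i; rewrite row0.
have wP : row i (kermx P) *m P = 0 by apply/sub_kermxP/row_sub.
move: (row i _) wP => w wP.
have : w^T *m w = 0.
  apply: sylvester_inj.
  by rewrite mulmxA -trmx_mul wP trmx0 mul0mx -mulmxA wP mulmx0 addr0.
move=> ww; apply/rowP => j; rewrite [RHS]mxE.
have /matrixP /(_ j j) := ww; rewrite !mxE big_ord1 mxE => /eqP.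
by rewrite mulf_eq0 orbb => /eqP.
Qed.

(** The Sylvester operator is injective on a finite-dimensional space, so it
    has a linear inverse; [L] is its matrix on vectorized matrices. *)
Lemma sylvester_solve : exists L : 'M[R]_(d * d), forall Y,
  mxvec Y = mxvec (P^T *m Y + Y *m P) *m L.
Proof.
pose f := (mulmx P^T \+ mulmxr P : 'M[R]_d -> 'M[R]_d).
have fr : row_free (lin_mx f).
  rewrite -kermx_eq0; apply/eqP/row_matrixP => i; rewrite row0.
  set w := row i _; have : w *m lin_mx f = 0 by apply/sub_kermxP/row_sub.
  rewrite mul_rV_lin => /eqP; rewrite mxvec_eq0 => /eqP /sylvester_inj e.
  by rewrite -[w]vec_mxK e linear0.
exists (invmx (lin_mx f)) => Y.
by rewrite -[P^T *m Y + _]/(f Y) -mul_vec_lin mulmxK // -row_free_unit.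
Qed.

(** The inverse of the Sylvester operator has constant coefficients. *)
Lemma sylvester_smooth n (W : set 'rV[R]_n) (Y C : 'rV[R]_n -> 'M[R]_d) :
  open W -> (forall x, W x -> P^T *m Y x + Y x *m P = C x) ->
  smooth W C -> smooth W Y.
Proof.
move=> oW YC sC; have [L LE] := sylvester_solve.
apply: smooth_mx => // a b.
have sV : smooth W (fun x => mxvec (C x)).
  apply: smooth_mx => // i k; case/mxvec_indexP: k => c e.
  apply: eq_smooth (smooth_entry c e oW sC) => // x _.
  by rewrite (ord1 i) mxvecE.
have sM := smooth_entry 0 (mxvec_index a b) oW
  (smooth_mulmx oW sV (@smooth_cst _ _ W _ L)).
by apply: eq_smooth sM => // x Wx; rewrite -YC // -LE mxvecE.
Qed.
End Sylvester.

(** * Algebra of the dressing matrix *)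

(** [mx_ring] proves identities between noncommutative polynomials in
    matrices: it expands the products, then compares the entries, every
    monomial being an atom. *)
Ltac mx_expand :=
  rewrite ?(mulmxDl, mulmxDr, mulmxBl, mulmxBr, mulmxN, mulNmx, mulmx1, mul1mx,
            mulmx0, mul0mx, mulmxA).

(** The products are locked because comparing two unlocked monomials up to
    conversion unfolds the matrix product. *)
Definition lmul (R : pzRingType) m n p (X : 'M[R]_(m, n)) (Y : 'M_(n, p)) :=
  locked (mulmx X Y).

Lemma lmulE (R : pzRingType) m n p (X : 'M[R]_(m, n)) (Y : 'M_(n, p)) :
  X *m Y = lmul X Y.
Proof. by rewrite /lmul -lock. Qed.

Lemma addmxE (V : zmodType) m n (X Y : 'M[V]_(m, n)) i j :
  (X + Y) i j = X i j + Y i j.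
Proof. by rewrite mxE. Qed.

Lemma oppmxE (V : zmodType) m n (X : 'M[V]_(m, n)) i j : (- X) i j = - X i j.
Proof. by rewrite mxE. Qed.

Lemma zeromxE (V : zmodType) m n i j : (0 : 'M[V]_(m, n)) i j = 0.
Proof. by rewrite mxE. Qed.

Ltac mx_ring := mx_expand; rewrite ?lmulE;
  let i := fresh "i" in let j := fresh "j" in
  apply/matrixP => i j; rewrite ?(addmxE, oppmxE, zeromxE); ring.

Section TransformAlgebra.
Context {R : fieldType} {d : nat} (P Om G : 'M[R]_d).
Hypothesis syl_inj : forall Y, P^T *m Y + Y *m P = 0 -> Y = 0.
Hypothesis Pu : P \in unitmx.
Hypothesis Omu : Om \in unitmx.
Hypothesis Gsym : G^T = G.
Hypothesis OmE :
  P^T *m Om^T + Om^T *m P = (P^T *m P^T + 1%:M) *m G *m P.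

Local Notation Q := (P^T).
Local Notation A := (invmx Om).
Local Notation B := (P + invmx P).
Local Notation S := (B *m A).

Let Qu : Q \in unitmx. Proof. by rewrite unitmx_tr. Qed.

(** The next identities are proved by applying X |-> P^t X + X P to both
    sides.  It commutes with left multiplication by P^t and with right
    multiplication by P, and its values at Omega and at Omega^t are known. *)
Lemma sylvester_cancel X Y : Q *m X + X *m P = Q *m Y + Y *m P -> X = Y.
Proof.
move=> e; apply/subr0_eq/syl_inj.
by rewrite mulmxBr mulmxBl addrACA -opprD e subrr.
Qed.

(* The transpose of [OmE]. *)
Let OmE' : Q *m Om + Om *m P = Q *m G *m (P *m P + 1%:M).
Proof.
have := congr1 trmx OmE.
rewrite linearD /= !trmx_mul !trmxK linearD /= trmx1 !trmx_mul trmxK Gsym.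
by rewrite addrC mulmxA.
Qed.

(** Between Omega^-t and Omega^-1, this is the real part of the unitarity of
    the new frame. *)
Lemma Omega_add_tr : Om + Om^T = G + Q *m G *m P.
Proof.
apply: sylvester_cancel.
transitivity ((Q *m Om + Om *m P) + (Q *m Om^T + Om^T *m P)); first by mx_ring.
by rewrite OmE' OmE; mx_ring.
Qed.

(** Between Omega^-t and Omega^-1, this is the imaginary part of the unitarity
    of the new frame. *)
Lemma Omega_sub_tr : Q *m Om - Om^T *m P = Q *m G - G *m P.
Proof.
apply: sylvester_cancel.
transitivity (Q *m (Q *m Om + Om *m P) - (Q *m Om^T + Om^T *m P) *m P).
  by mx_ring.
by rewrite OmE' OmE; mx_ring.
Qed.

Let trB : B^T = Q + invmx Q.
Proof. by rewrite linearD /= trmx_inv. Qed.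

Lemma Omega_mul_sym : B^T *m Om = Om^T *m B.
Proof.
rewrite trB; apply: sylvester_cancel.
transitivity ((Q + invmx Q) *m (Q *m Om + Om *m P)).
  by mx_expand; rewrite mulVmx // mulmxV // !mul1mx; mx_ring.
transitivity ((Q *m Om^T + Om^T *m P) *m (P + invmx P)); last first.
  by mx_expand; rewrite mulmxKV // mulmxK // ; mx_ring.
rewrite OmE' OmE; mx_expand; rewrite mulVmx // mul1mx !mulmxK //.
by mx_ring.
Qed.

Lemma dressing_sym : S^T = S.
Proof.
rewrite trmx_mul trmx_inv.
apply: (can_inj (mulKmx (_ : Om^T \in unitmx))); first by rewrite unitmx_tr.
apply: (can_inj (mulmxK Omu)).
by rewrite mulKVmx ?unitmx_tr // Omega_mul_sym !mulmxA mulmxKV.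
Qed.

Lemma dressing_trE : A^T *m (Q + invmx Q) = S.
Proof. by rewrite -dressing_sym trmx_mul trB. Qed.

Let uOmT : Om^T \in unitmx. Proof. by rewrite unitmx_tr. Qed.
Let trA : A^T = invmx Om^T. Proof. by rewrite trmx_inv. Qed.

Lemma invOmega_gram_sym : A^T *m (G + Q *m G *m P) *m A = A^T + A.
Proof.
rewrite -Omega_add_tr mulmxDr mulmxDl -mulmxA mulmxV // mulmx1.
by rewrite trA mulVmx // mul1mx.
Qed.

Lemma invOmega_gram_skew : A^T *m (Q *m G - G *m P) *m A = A^T *m Q - P *m A.
Proof.
rewrite -Omega_sub_tr mulmxBr mulmxBl -!mulmxA mulmxV // mulmx1.
by rewrite trA !mulmxA mulVmx // mul1mx.
Qed.

(** This is the equation for Omega^t, multiplied by the inverse of P^t on the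
    left and by that of P on the right, then by Omega^-t on both sides. *)
Lemma dressing_gram_inv : S *m G *m A^T = A^T *m invmx Q + invmx P *m A^T.
Proof.
have e : invmx Q *m Om^T + Om^T *m invmx P = (Q + invmx Q) *m G.
  apply: (can_inj (mulKmx Qu)); apply: (can_inj (mulmxK Pu)).
  transitivity (Q *m Om^T + Om^T *m P).
    by mx_expand; rewrite mulmxV // mul1mx mulmxKV // addrC.
  by rewrite OmE; mx_expand; rewrite mulmxV // mul1mx.
rewrite -dressing_trE -[A^T *m _ *m G]mulmxA -e; mx_expand.
by rewrite trA mulVmx // mul1mx mulmxK.
Qed.

Lemma dressing_gram : S *m G *m S = invmx P *m S + S *m invmx Q.
Proof.
rewrite -{2}dressing_trE mulmxA dressing_gram_inv -dressing_trE; mx_expand.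
rewrite mulmxKV // mulmxK // ; mx_ring.
Qed.
End TransformAlgebra.

(** * Pointwise transformation of a unitary frame *)

Lemma trmxB (V : zmodType) m n (X Y : 'M[V]_(m, n)) : (X - Y)^T = X^T - Y^T.
Proof. by apply/matrixP => i j; rewrite !mxE. Qed.

Lemma trmxD (V : zmodType) m n (X Y : 'M[V]_(m, n)) : (X + Y)^T = X^T + Y^T.
Proof. by apply/matrixP => i j; rewrite !mxE. Qed.

Lemma trmxN (V : zmodType) m n (X : 'M[V]_(m, n)) : (- X)^T = - X^T.
Proof. by apply/matrixP => i j; rewrite !mxE. Qed.

Section PointTransform.
Context {R : fieldType} {d n m : nat} (P Om : 'M[R]_d) (T : 'M[R]_(n, d))
  (E : 'M[R]_(n, m)) (J : 'M[R]_m).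
Hypothesis syl_inj : forall Y, P^T *m Y + Y *m P = 0 -> Y = 0.
Hypothesis Pu : P \in unitmx.
Hypothesis Omu : Om \in unitmx.
Hypothesis OmE :
  P^T *m Om^T + Om^T *m P = (P^T *m P^T + 1%:M) *m (T^T *m T) *m P.
Hypothesis JJ : J *m J = - 1%:M.
Hypothesis trJ : J^T = - J.

Local Notation Q := (P^T).
Local Notation A := (invmx Om).
Local Notation B := (P + invmx P).
Local Notation S := (B *m A).
Local Notation M := (T^T *m E + Q *m (T^T *m E) *m J).
Local Notation E' := (E - T *m A^T *m M).

Let Gsym : (T^T *m T)^T = T^T *m T. Proof. by rewrite trmx_mul trmxK. Qed.
Let Qu : Q \in unitmx. Proof. by rewrite unitmx_tr. Qed.

Let XX_ZZ : T *m A^T *m T^T *m (T *m A^T *m T^T)^T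
  + T *m A^T *m Q *m T^T *m (T *m A^T *m Q *m T^T)^T
  = T *m A^T *m T^T + (T *m A^T *m T^T)^T.
Proof.
have e := invOmega_gram_sym syl_inj Omu Gsym OmE.
transitivity (T *m (A^T *m (T^T *m T + Q *m (T^T *m T) *m P) *m A) *m T^T).
  by rewrite !trmx_mul !trmxK; mx_ring.
by rewrite e !trmx_mul !trmxK; mx_ring.
Qed.

Let ZX_XZ : T *m A^T *m Q *m T^T *m (T *m A^T *m T^T)^T
  - T *m A^T *m T^T *m (T *m A^T *m Q *m T^T)^T
  = T *m A^T *m Q *m T^T - (T *m A^T *m Q *m T^T)^T.
Proof.
have e := invOmega_gram_skew syl_inj Omu Gsym OmE.
transitivity (T *m (A^T *m (Q *m (T^T *m T) - (T^T *m T) *m P) *m A) *m T^T).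
  by rewrite !trmx_mul !trmxK; mx_ring.
by rewrite e !trmx_mul !trmxK; mx_ring.
Qed.

(** In complex notation E' = (1 - X - i Z) E, with the matrices X and Z of
    [XX_ZZ] and [ZX_XZ]; these two identities say that 1 - X - i Z is
    unitary. *)
Lemma frame_transformE :
  E' = (1%:M - T *m A^T *m T^T) *m E - T *m A^T *m Q *m T^T *m E *m J.
Proof. by mx_ring. Qed.

Hypothesis EE : E *m E^T = 1%:M.
Hypothesis EJE : E *m J *m E^T = 0.

Lemma frame_transform_orth : E' *m E'^T = 1%:M.
Proof.
rewrite frame_transformE; move: XX_ZZ; set X := T *m A^T *m T^T.
set Z := T *m A^T *m Q *m T^T => e; clearbody X Z.
have J1 : J *m J^T = 1%:M by rewrite trJ mulmxN JJ opprK.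
have EJE' : E *m J^T *m E^T = 0 by rewrite trJ mulmxN mulNmx EJE oppr0.
rewrite !trmxB !trmx_mul trmxB trmx1.
transitivity ((1%:M - X) *m (E *m E^T) *m (1%:M - X^T)
  - (1%:M - X) *m (E *m J^T *m E^T) *m Z^T - Z *m (E *m J *m E^T) *m (1%:M - X^T)
  + Z *m (E *m (J *m J^T) *m E^T) *m Z^T); first by mx_ring.
rewrite EJE EJE' J1 mulmx1 EE !mulmx0 !mul0mx !subr0 mulmx1.
transitivity (1%:M - (X + X^T) + (X *m X^T + Z *m Z^T)); first by mx_ring.
by rewrite e subrK.
Qed.

Lemma frame_transform_lag : E' *m J *m E'^T = 0.
Proof.
rewrite frame_transformE; move: ZX_XZ; set X := T *m A^T *m T^T.
set Z := T *m A^T *m Q *m T^T => e; clearbody X Z.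
rewrite !trmxB !trmx_mul trmxB trmx1 trJ.
transitivity ((1%:M - X) *m (E *m J *m E^T) *m (1%:M - X^T)
  + (1%:M - X) *m (E *m (J *m J) *m E^T) *m Z^T
  - Z *m (E *m (J *m J) *m E^T) *m (1%:M - X^T)
  - Z *m (E *m (J *m J) *m J *m E^T) *m Z^T); first by mx_ring.
have -> : E *m (J *m J) *m J *m E^T = 0.
  by rewrite JJ mulmxN mulmx1 !mulNmx EJE oppr0.
have -> : E *m (J *m J) *m E^T = - 1%:M by rewrite JJ mulmxN mulmx1 mulNmx EE.
rewrite EJE.
transitivity (Z - Z^T - (Z *m X^T - X *m Z^T)); first by mx_ring.
by rewrite e subrr.
Qed.

(** The left-hand side is the derivative of E' obtained from the product rule,
    with C the connection matrix and D the matrix unit of the direction; on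
    the right-hand side it is in the form required of a Lagrangian frame, with
    C replaced by the new connection.  The difference of the two sides is
    D times the identity [key], which follows from the value of
    S T^t T Omega^-t. *)
Lemma frame_transform_diff (D C : 'M[R]_n) :
  C *m E + D *m E *m J
  - (C *m T *m A^T - D *m T *m invmx P *m A^T
     + T *m S *m T^T *m D *m T *m A^T) *m M
  + T *m A^T *m (Q + invmx Q) *m T^T *m D *m E
  = (C + (T *m S *m T^T *m D - D *m (T *m S *m T^T))) *m E' + D *m E' *m J.
Proof.
have e1 := dressing_trE syl_inj Pu Omu Gsym OmE.
have e2 := dressing_gram_inv syl_inj Pu Omu Gsym OmE.
have key : T *m invmx P *m A^T *m M = - (T *m S *m T^T *m E)
    + T *m (S *m (T^T *m T) *m A^T) *m M - T *m A^T *m M *m J.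
  rewrite e2 -e1; mx_expand; rewrite -[_ *m J *m J]mulmxA JJ.
  by mx_expand; rewrite (mulmxKV Qu); mx_ring.
rewrite -[T *m A^T *m (Q + _)]mulmxA e1.
move: (M) key => M0 key.
set E1 := E - T *m A^T *m M0.
transitivity (C *m E1 + T *m S *m T^T *m D *m E1 + D *m E *m J
  + D *m (T *m invmx P *m A^T *m M0)); rewrite /E1.
  by mx_ring.
by rewrite key; mx_ring.
Qed.
End PointTransform.

(** * Lagrangian frames and their transforms *)

Section Frames.
Context {R : realType} {n : nat} (W : set 'rV[R]_n) (oW : open W).
Local Notation J := (Jmx R n).

Lemma JmxK : J *m J = - 1%:M.
Proof.
rewrite /Jmx mulmx_block !mul0mx !mulmx0 !mul1mx !mulmx1 !addr0 !add0r.
by rewrite [in RHS]scalar_mx_block opp_block_mx oppr0.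
Qed.

Lemma trJmx : J^T = - J.
Proof.
by rewrite /Jmx tr_block_mx !trmx0 linearN /= trmx1 opp_block_mx oppr0 opprK.
Qed.

(** The connection matrix omega_i = H D_i - D_i H, in the direction d_i, of the
    frame X_j for the metric with rotation coefficients h_ij: row j holds the
    components of nabla_{d_i} X_j.  The diagonal of [H] drops out of it, so
    that H + T S T^t can be used without correcting its diagonal. *)
Definition connection (H : 'M[R]_n) (i : 'I_n) : 'M[R]_n :=
  H *m delta_mx i i - delta_mx i i *m H.

(** [E] is a unitary frame tangent to [f], adapted to principal coordinates
    with rotation coefficients [H]; the term D_i E J says that the second
    fundamental form is diagonal with alpha(d_i, X_i) = J E_i. *)
Record lagrangian_frame (f : 'rV[R]_n -> 'rV[R]_(n + n))
    (v : 'rV[R]_n -> 'rV[R]_n) (H : 'rV[R]_n -> 'M[R]_n)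
    (E : 'rV[R]_n -> 'M[R]_(n, n + n)) : Prop := LagrangianFrame {
  frame_smooth_f : smooth W f;
  frame_smooth_E : smooth W E;
  frame_smooth_v : smooth W v;
  frame_smooth_H : smooth W H;
  frame_H_sym : forall x, W x -> (H x)^T = H x;
  frame_f : forall i, has_partial W i f (fun x => v x 0 i *: row i (E x));
  frame_E : forall i, has_partial W i E
    (fun x => connection (H x) i *m E x + delta_mx i i *m E x *m J);
  frame_orth : forall x, W x -> E x *m (E x)^T = 1%:M;
  frame_lag : forall x, W x -> E x *m J *m (E x)^T = 0 }.

Lemma tr_connection (H : 'M[R]_n) i : H^T = H ->
  (connection H i)^T = - connection H i.
Proof. by move=> sH; rewrite trmxB !trmx_mul trmx_delta sH opprB. Qed.

Lemma mul_row_delta_diag (u : 'rV[R]_n) i :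
  u *m delta_mx i i = u 0 i *: delta_mx 0 i.
Proof.
apply/rowP => j; rewrite !mxE (bigD1 i) //= big1 ?addr0 ?mxE ?eqxx //.
by move=> k /negPf ki; rewrite mxE ki mulr0.
Qed.

Lemma mul_delta_diag p q (X : 'M[R]_(p, n)) (Y : 'M[R]_(n, q)) i j k :
  (X *m delta_mx i i *m Y) j k = X j i * Y i k.
Proof.
rewrite -(mul_delta_mx (0 : 'I_1)) mulmxA -mulmxA -colE -rowE mxE big_ord1.
by rewrite !mxE.
Qed.

Lemma delta_diag_mull p (X : 'M[R]_(n, p)) i j k : j != i ->
  (delta_mx i i *m X) j k = 0.
Proof.
move=> /negPf ji; rewrite -[delta_mx i i]mul1mx mul_delta_diag mxE ji.
by rewrite mul0r.
Qed.

Lemma delta_diag_mulr p (X : 'M[R]_(p, n)) i j k : k != i ->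
  (X *m delta_mx i i) j k = 0.
Proof.
rewrite eq_sym => /negPf ik; rewrite -[X *m _]mulmx1 mul_delta_diag mxE ik.
by rewrite mulr0.
Qed.

Lemma connectionE (H : 'M[R]_n) i j k : connection H i j k =
  H j i * (k == i)%:R - (j == i)%:R * H i k.
Proof.
rewrite /connection addmxE oppmxE; congr (_ - _).
  by rewrite -[_ *m _]mulmx1 mul_delta_diag mxE [i == k]eq_sym.
by rewrite -[delta_mx i i]mul1mx mul_delta_diag mxE.
Qed.

Lemma connection_mull p (H : 'M[R]_n) (X : 'M[R]_(n, p)) i j k : j != i ->
  (connection H i *m X) j k = H j i * X i k.
Proof.
move=> ji; rewrite /connection mulmxBl addmxE oppmxE mul_delta_diag -mulmxA.
by rewrite delta_diag_mull // subr0.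
Qed.

Lemma connection_mulr p (H : 'M[R]_n) (X : 'M[R]_(p, n)) i j k : k != i ->
  (X *m connection H i) j k = - (X j i * H i k).
Proof.
move=> ki; rewrite /connection mulmxBr addmxE oppmxE !mulmxA mul_delta_diag.
by rewrite delta_diag_mulr // sub0r.
Qed.

Lemma sum_delta_diag : \sum_i delta_mx i i = 1%:M :> 'M[R]_n.
Proof. by rewrite -mx1_sum_delta. Qed.

(** This makes the connection terms disappear from sum_l d_l h'_ij. *)
Lemma sum_connection (H : 'M[R]_n) : \sum_i connection H i = 0.
Proof.
by rewrite sumrB -mulmx_sumr -mulmx_suml sum_delta_diag mulmx1 mul1mx subrr.
Qed.

Record frame_system (v : 'rV[R]_n -> 'rV[R]_n) (H : 'rV[R]_n -> 'M[R]_n) :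
  Prop :=
  FrameSystem {
  system_v : forall i j x, W x -> i != j ->
    partial j (fun y => v y 0 i) x = H x i j * v x 0 j;
  system_sum : forall i j x, W x -> i != j ->
    \sum_l partial l (fun y => H y i j) x = 0;
  system_h : forall i j l x, W x -> l != i -> i != j -> j != l ->
    partial l (fun y => H y i j) x = H x i l * H x j l }.

Section Transform.
Context {d : nat} (P : 'M[R]_d).
Context (f : 'rV[R]_n -> 'rV[R]_(n + n)) (v : 'rV[R]_n -> 'rV[R]_n)
  (H : 'rV[R]_n -> 'M[R]_n) (E : 'rV[R]_n -> 'M[R]_(n, n + n)).
Context (rho : 'rV[R]_n -> 'rV[R]_d) (T : 'rV[R]_n -> 'M[R]_(n, d))
  (Om : 'rV[R]_n -> 'M[R]_d).
Hypothesis frE : lagrangian_frame f v H E.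
Hypothesis syl_inj : forall Y, P^T *m Y + Y *m P = 0 -> Y = 0.
Hypothesis Pu : P \in unitmx.
Hypothesis Omu : forall x, W x -> Om x \in unitmx.
Hypothesis OmE : forall x, W x ->
  P^T *m (Om x)^T + (Om x)^T *m P =
  (P^T *m P^T + 1%:M) *m ((T x)^T *m T x) *m P.
Hypothesis sOm : smooth W Om.
Hypothesis srho : smooth W rho.
Hypothesis sT : smooth W T.
Hypothesis hrho : forall i, has_partial W i rho (fun x => v x 0 i *: row i (T x)).
Hypothesis hT : forall i, has_partial W i T
  (fun x => connection (H x) i *m T x - delta_mx i i *m T x *m invmx P).

Local Notation Q := (P^T).
Local Notation B := (P + invmx P).
Local Notation A := (fun x => invmx (Om x)).
Local Notation S := (fun x => B *m invmx (Om x)).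
Local Notation M := (fun x => (T x)^T *m E x + Q *m ((T x)^T *m E x) *m J).

(** The transformed data, in matrix form; [dressed_e] is the frame tangent to
    [dressed_map]. *)
Definition dressed_v x := v x + rho x *m S x *m (T x)^T.
Definition dressed_h x := H x + T x *m S x *m (T x)^T.
Definition dressed_e x := E x - T x *m (invmx (Om x))^T *m M x.
Definition dressed_map x := f x - rho x *m (invmx (Om x))^T *m M x.

Let hcst p q i (X : 'M[R]_(p, q)) := @has_partial_cst _ _ W _ i X.

Let Gsym x : ((T x)^T *m T x)^T = (T x)^T *m T x.
Proof. by rewrite trmx_mul trmxK. Qed.

Let Ssym x : W x -> (S x)^T = S x.
Proof. by move=> Wx; apply: dressing_sym (OmE Wx) => //; exact: Omu. Qed.

Let StrE x : W x -> (A x)^T *m (Q + invmx Q) = S x.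
Proof. by move=> Wx; apply: dressing_trE (OmE Wx) => //; exact: Omu. Qed.

(** The connection is antisymmetric and cancels. *)
Lemma has_partial_gram i : has_partial W i (fun x => (T x)^T *m T x)
  (fun x => - ((T x)^T *m delta_mx i i *m T x *m invmx P)
            - invmx Q *m (T x)^T *m delta_mx i i *m T x).
Proof.
apply: (eq_has_partial oW
  (has_partial_mulmx oW (has_partial_trmx oW (hT i)) (hT i))) => // x Wx.
rewrite trmxB !trmx_mul tr_connection ?(frame_H_sym frE) // trmx_inv trmx_delta.
by mx_ring.
Qed.

(** Both sides of the Sylvester equation for Omega^t are differentiated; its
    solution is unique. *)
Lemma has_partial_Omega i : has_partial W i Om
  (fun x => - ((T x)^T *m delta_mx i i *m T x *m B)).
Proof.
split => // x Wx.
have hOm := has_partialT i sOm.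
have hY := has_partial_trmx oW hOm.
have hL := has_partialD oW (has_partial_mulmx oW (hcst i Q) hY)
  (has_partial_mulmx oW hY (hcst i P)).
have hR := has_partial_mulmx oW (has_partial_mulmx oW (hcst i (Q *m Q + 1%:M))
  (has_partial_gram i)) (hcst i P).
have [_ e1] := eq_has_partial oW hL OmE (fun _ _ => erefl).
have [_ e2] := hR.
have e := etrans (esym (e1 x Wx)) (e2 x Wx).
apply: trmx_inj; apply: (sylvester_cancel syl_inj).
move: (partial i Om x) e => D e.
have -> : Q *m D^T + D^T *m P =
  0 *m (Om x)^T + Q *m D^T + (D^T *m P + (Om x)^T *m 0) by mx_ring.
rewrite e trmxN !trmx_mul trmxD trmx_inv trmxK trmx_delta.
mx_expand; rewrite !(mulmxKV Pu) (mulmxV (_ : Q \in unitmx)) ?unitmx_tr //.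
by rewrite mulmxK ?unitmx_tr // !mul1mx; mx_ring.
Qed.

Let partial_invOmega i : has_partial W i (fun x => (A x)^T)
  (fun x => S x *m (T x)^T *m delta_mx i i *m T x *m (A x)^T).
Proof.
apply: (eq_has_partial oW (has_partial_trmx oW
  (has_partial_invmx oW Omu (has_partial_Omega i)))) => // x Wx.
rewrite mulmxN mulNmx opprK !mulmxA -[_ *m B *m _]mulmxA trmx_mul Ssym //.
by rewrite !trmx_mul trmxK trmx_delta !mulmxA.
Qed.

Let partial_sigma i : has_partial W i (fun x => rho x *m (A x)^T)
  (fun x => dressed_v x 0 i *: row i (T x *m (A x)^T)).
Proof.
apply: (eq_has_partial oW (has_partial_mulmx oW (hrho i)
  (partial_invOmega i))) => // x Wx.
rewrite mxE scalerDl !row_mul -!scalemxAl; congr (_ + _).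
rewrite !mulmxA mul_row_delta_diag -!scalemxAl; congr (_ *: _).
by rewrite [row i (T x)]rowE.
Qed.

Let partial_M i : has_partial W i M
  (fun x => - ((Q + invmx Q) *m (T x)^T *m delta_mx i i *m E x)).
Proof.
have hK := has_partial_mulmx oW (has_partial_trmx oW (hT i)) (frame_E frE i).
apply: (eq_has_partial oW (has_partialD oW hK (has_partial_mulmx oW
  (has_partial_mulmx oW (hcst i Q) hK) (hcst i J)))) => // x Wx.
rewrite trmxB !trmx_mul tr_connection ?(frame_H_sym frE) // trmx_inv trmx_delta.
mx_expand; rewrite -!mulmxA JmxK (mulKVmx (_ : Q \in unitmx)) ?unitmx_tr //.
by mx_ring.
Qed.

(** The derivative of phi^t Omega^-t is v'_i e_i T Omega^-t, and the derivative
    of its cofactor [M] is -(P^t + P^-t) T^t D_i E: the latter turns v_i into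
    v'_i in front of e_i E. *)
Lemma dressed_map_partial i :
  has_partial W i dressed_map (fun x => dressed_v x 0 i *: row i (dressed_e x)).
Proof.
apply: (eq_has_partial oW (has_partialB oW (frame_f frE i)
  (has_partial_mulmx oW (partial_sigma i) (partial_M i)))) => // x Wx.
rewrite /dressed_e linearB /= scalerBr [row i (_ *m M x)]row_mul scalemxAl.
rewrite opprD addrCA addrC; congr (_ + _).
rewrite mulmxN opprK !mulmxA -[_ *m _^T *m (Q + _)]mulmxA StrE //.
rewrite mul_row_delta_diag -scalemxAl -rowE -scalerDl.
by congr (_ *: _); rewrite [RHS]mxE.
Qed.

Lemma dressed_e_partial i : has_partial W i dressed_e
  (fun x => connection (dressed_h x) i *m dressed_e x
            + delta_mx i i *m dressed_e x *m J).
Proof.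
apply: (eq_has_partial oW (has_partialB oW (frame_E frE i)
  (has_partial_mulmx oW (has_partial_mulmx oW (hT i) (partial_invOmega i))
    (partial_M i)))) => // x Wx.
have e := frame_transform_diff (E x) syl_inj Pu (Omu Wx) (OmE Wx) JmxK
  (delta_mx i i) (connection (H x) i).
have -> : connection (dressed_h x) i = connection (H x) i
  + (T x *m S x *m (T x)^T *m delta_mx i i
     - delta_mx i i *m (T x *m S x *m (T x)^T)).
  by rewrite /connection /dressed_h; mx_ring.
rewrite /dressed_e -e; move: (M x) => M0; move: (connection _ _) => C.
by mx_ring.
Qed.

Let partial_dressing i : has_partial W i S
  (fun x => S x *m (T x)^T *m delta_mx i i *m T x *m S x).
Proof.
apply: (eq_has_partial oW (has_partial_mulmx oW (hcst i B)
  (has_partial_invmx oW Omu (has_partial_Omega i)))) => // x Wx.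
by rewrite mul0mx add0r; mx_ring.
Qed.

(* The last two terms only contribute to the entries of row and column i; for
   the others the formula reads d_i s_jk = h_ij s_ik + h_ik s_ij + s_ij s_ik. *)
Let partial_TST i : has_partial W i (fun x => T x *m S x *m (T x)^T)
  (fun x => let s := T x *m S x *m (T x)^T in
     (connection (H x) i *m s - s *m connection (H x) i) + s *m delta_mx i i *m s
     - delta_mx i i *m T x *m invmx P *m S x *m (T x)^T
     - T x *m S x *m invmx Q *m (T x)^T *m delta_mx i i).
Proof.
apply: (eq_has_partial oW (has_partial_mulmx oW
  (has_partial_mulmx oW (hT i) (partial_dressing i))
  (has_partial_trmx oW (hT i)))) => // x Wx.
rewrite trmxB !trmx_mul tr_connection ?(frame_H_sym frE) // trmx_inv trmx_delta.
move: (connection _ _) (S x) => C S0 /=.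
by mx_ring.
Qed.

Let TST_sym x : W x -> (T x *m S x *m (T x)^T)^T = T x *m S x *m (T x)^T.
Proof. by move=> Wx; rewrite trmx_mul trmxK trmx_mul Ssym // mulmxA. Qed.

Let smooth_dressing : smooth W S.
Proof.
by apply: smooth_mulmx => //; [exact: smooth_cst | exact: smooth_invmx].
Qed.

Lemma transform_lagrangian_frame :
  lagrangian_frame dressed_map dressed_v dressed_h dressed_e.
Proof.
have sA : smooth W (fun x => (A x)^T).
  by apply: smooth_trmx => //; exact: smooth_invmx.
have sTt : smooth W (fun x => (T x)^T) by apply: smooth_trmx.
have sE := frame_smooth_E frE.
have sM : smooth W M.
  apply: smoothD => //; first exact: smooth_mulmx.
  apply: (smooth_mulmx oW _ (@smooth_cst _ _ W _ J)).
  by apply: (smooth_mulmx oW (@smooth_cst _ _ W _ Q)); apply: smooth_mulmx.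
split.
- apply: smoothB => //; first exact: frame_smooth_f frE.
  by apply: smooth_mulmx => //; apply: smooth_mulmx.
- by apply: smoothB => //; apply: smooth_mulmx => //; apply: smooth_mulmx.
- apply: smoothD => //; first exact: frame_smooth_v frE.
  by apply: smooth_mulmx => //; apply: smooth_mulmx.
- apply: smoothD => //; first exact: frame_smooth_H frE.
  by apply: smooth_mulmx => //; apply: smooth_mulmx.
- by move=> x Wx; rewrite /dressed_h trmxD TST_sym // (frame_H_sym frE).
- exact: dressed_map_partial.
- exact: dressed_e_partial.
- move=> x Wx; apply: (frame_transform_orth syl_inj (Omu Wx) (OmE Wx) JmxK trJmx).
  + exact: frame_orth frE _ Wx.
  + exact: frame_lag frE _ Wx.
- move=> x Wx; apply: (frame_transform_lag syl_inj (Omu Wx) (OmE Wx) JmxK trJmx).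
  + exact: frame_orth frE _ Wx.
  + exact: frame_lag frE _ Wx.
Qed.

Hypothesis sysE : frame_system v H.

Let sH := frame_smooth_H frE.

Let partial_dressed_h i j l x : W x ->
  partial l (fun y => dressed_h y i j) x = partial l (fun y => H y i j) x +
  (let s := T x *m S x *m (T x)^T in
     (connection (H x) l *m s - s *m connection (H x) l) + s *m delta_mx l l *m s
     - delta_mx l l *m T x *m invmx P *m S x *m (T x)^T
     - T x *m S x *m invmx Q *m (T x)^T *m delta_mx l l) i j.
Proof.
move=> Wx; have hH := has_partialT l (smooth_entry i j oW sH).
have [_ e] := eq_has_partial oW (has_partialD oW hH
  (has_partial_entry oW i j (partial_TST l)))
  (fun y _ => esym (addmxE (H y) _ i j)) (fun _ _ => erefl).
exact: e.
Qed.

Let partial_dressed_v i j x : W x -> i != j ->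
  partial j (fun y => dressed_v y 0 i) x = partial j (fun y => v y 0 i) x +
  (dressed_v x 0 j * (T x *m S x *m (T x)^T) j i
   + (rho x *m S x *m (T x)^T) 0 j * H x j i).
Proof.
move=> Wx ij; have hv := has_partialT j (smooth_entry 0 i oW (frame_smooth_v frE)).
have hw := has_partial_mulmx oW (has_partial_mulmx oW (hrho j) (partial_dressing j))
  (has_partial_trmx oW (hT j)).
have [_ e] := eq_has_partial oW (has_partialD oW hv (has_partial_entry oW 0 i hw))
  (fun y _ => esym (addmxE (v y) _ 0 i)) (fun _ _ => erefl).
apply: etrans (e x Wx) _; congr (_ + _).
rewrite trmxB !trmx_mul tr_connection ?(frame_H_sym frE) // trmx_inv trmx_delta.
rewrite [dressed_v x 0 j]mxE; move: (S x) => S0.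
set r := v x 0 j *: row j (T x).
transitivity ((r *m S0 *m (T x)^T
  + rho x *m S0 *m (T x)^T *m delta_mx j j *m (T x *m S0 *m (T x)^T)
  - rho x *m S0 *m (T x)^T *m connection (H x) j
  - rho x *m S0 *m invmx Q *m (T x)^T *m delta_mx j j) 0 i).
  by congr (fun_of_matrix _ 0 i); clearbody r; mx_ring.
rewrite !(addmxE, oppmxE) mul_delta_diag connection_mulr // delta_diag_mulr //.
have -> : (r *m S0 *m (T x)^T) 0 i = v x 0 j * (T x *m S0 *m (T x)^T) j i.
  by rewrite /r -!scalemxAl mxE -!row_mul mxE.
by ring.
Qed.

(** For the sum over l, the connection terms cancel by [sum_connection] and
    the others by the value of S T^t T S. *)
Lemma transform_frame_system : frame_system dressed_v dressed_h.
Proof.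
split.
- move=> i j x Wx ij; apply: etrans (partial_dressed_v Wx ij) _.
  rewrite (system_v sysE Wx ij).
  have Hs : H x j i = H x i j by rewrite -[in LHS](frame_H_sym frE Wx) mxE.
  have ss := TST_sym Wx; have sij : (T x *m S x *m (T x)^T) j i =
    (T x *m S x *m (T x)^T) i j by rewrite -[in LHS]ss mxE.
  rewrite Hs sij [dressed_h x i j]addmxE [dressed_v x 0 j]addmxE.
  by ring.
- move=> i j x Wx ij.
  have e l := partial_dressed_h i j l Wx.
  apply: etrans (eq_bigr _ (fun l _ => e l)) _.
  rewrite big_split /= (system_sum sysE Wx ij) add0r.
  rewrite -summxE !(sumrB, big_split) /= -!mulmx_suml -!mulmx_sumr sum_connection.
  rewrite sum_delta_diag mul0mx mulmx0 subrr add0r !mulmx1 !mul1mx.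
  have eG := dressing_gram syl_inj Pu (Omu Wx) (Gsym x) (OmE Wx).
  have -> : T x *m S x *m (T x)^T *m (T x *m S x *m (T x)^T) =
    T x *m (S x *m ((T x)^T *m T x) *m S x) *m (T x)^T by rewrite !mulmxA.
  rewrite eG; move: (S x) => S0.
  have -> : T x *m (invmx P *m S0 + S0 *m invmx Q) *m (T x)^T =
    T x *m invmx P *m S0 *m (T x)^T + T x *m S0 *m invmx Q *m (T x)^T by mx_ring.
  by rewrite addrAC addrK subrr mxE.
- move=> i j l x Wx li ij jl.
  apply: etrans (partial_dressed_h i j l Wx) _.
  rewrite (system_h sysE Wx li ij jl) /=.
  have Hs : H x l j = H x j l by rewrite -[in LHS](frame_H_sym frE Wx) mxE.
  have ss := TST_sym Wx; have sij : (T x *m S x *m (T x)^T) l j =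
    (T x *m S x *m (T x)^T) j l by rewrite -[in LHS]ss mxE.
  rewrite [dressed_h x i l]addmxE [dressed_h x j l]addmxE -sij -Hs.
  rewrite -[delta_mx l l *m _ *m _ *m _ *m _]mulmxA.
  rewrite -[delta_mx l l *m _ *m _ *m _]mulmxA -[delta_mx l l *m _ *m _]mulmxA.
  move: (S x) => S0; set s := T x *m _ *m _.
  rewrite !(addmxE, oppmxE) connection_mull 1?eq_sym // connection_mulr //.
  rewrite mul_delta_diag delta_diag_mull 1?eq_sym // delta_diag_mulr //.
  by ring.
Qed.
End Transform.
End Frames.

(** * Geometry of a unitary frame at a point *)

Section FrameGeometry.
Context {R : realType} {n : nat}.
Local Notation J := (Jmx R n).

(** The rows of E and of E J form an orthonormal basis. *)
Lemma frame_complete (E : 'M[R]_(n, n + n)) : E *m E^T = 1%:M ->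
  E *m J *m E^T = 0 -> E^T *m E + (E *m J)^T *m (E *m J) = 1%:M.
Proof.
move=> EE EJE; pose F := col_mx E (E *m J).
have EJE2 : E *m (E *m J)^T = 0.
  by rewrite trmx_mul trJmx mulNmx mulmxN mulmxA EJE oppr0.
have EJJ : E *m J *m (E *m J)^T = 1%:M.
  by rewrite trmx_mul trJmx mulNmx mulmxN mulmxA -[E *m J *m J]mulmxA JmxK
             mulmxN mulNmx opprK mulmx1.
have FF : F *m F^T = 1%:M.
  by rewrite /F tr_col_mx mul_col_row EE EJE2 EJE EJJ -scalar_mx_block.
by move: (mulmx1C FF); rewrite /F tr_col_mx mul_row_col.
Qed.

Lemma row_jacobian m (f : 'rV[R]_n -> 'rV[R]_m) x i : differentiable f x ->
  row i (jacobian f x) = partial i f x.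
Proof. by move=> df; rewrite rowE /partial deriveEjacobian. Qed.

Section Pointwise.
Context (f : 'rV[R]_n -> 'rV[R]_(n + n)) (x : 'rV[R]_n) (v : 'rV[R]_n)
  (E : 'M[R]_(n, n + n)).
Hypothesis jacE : jacobian f x = diag_mx v *m E.
Hypothesis v0 : forall i, v 0 i != 0.
Hypothesis EE : E *m E^T = 1%:M.
Hypothesis EJE : E *m J *m E^T = 0.

Lemma unit_diag : diag_mx v \in unitmx.
Proof. by rewrite unitmxE det_diag unitfE; apply/prodf_neq0 => i _. Qed.

Lemma frame_jacobian : E = invmx (diag_mx v) *m jacobian f x.
Proof. by rewrite jacE mulKmx // unit_diag. Qed.

Lemma frame_metric : induced_metric f x = diag_mx (\row_j v 0 j ^+ 2).
Proof.
rewrite /induced_metric jacE trmx_mul tr_diag_mx mulmxA -[_ *m E^T]mulmxA EE mulmx1.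
rewrite mulmx_diag; congr diag_mx; apply/rowP => j; by rewrite !mxE expr2.
Qed.

Lemma frame_row_free : row_free (jacobian f x).
Proof.
apply/row_freeP; exists (E^T *m invmx (diag_mx v)).
by rewrite jacE mulmxA -[_ *m E^T]mulmxA EE mulmx1 mulmxV // unit_diag.
Qed.

Lemma sub_normal_space p (Y : 'M[R]_(p, n + n)) :
  (Y <= Defs.normal_space f x)%MS = (Y *m E^T == 0).
Proof.
rewrite /Defs.normal_space sub_kermx jacE trmx_mul tr_diag_mx mulmxA.
apply/eqP/eqP => [e|->]; last by rewrite mul0mx.
by rewrite -[LHS](mulmxK unit_diag) e mul0mx.
Qed.

(** One inclusion is E J E^t = 0; the two spaces have the same dimension n. *)
Lemma frame_is_lagrangian : (jacobian f x *m J == Defs.normal_space f x)%MS.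
Proof.
have le : (jacobian f x *m J <= Defs.normal_space f x)%MS.
  by rewrite sub_normal_space jacE -!mulmxA [E *m _]mulmxA EJE mulmx0.
rewrite -(mxrank_leqif_eq le) /Defs.normal_space mxrank_ker mxrank_tr.
have Ju : J \in unitmx.
  have /mulmx1_unit[] // : J *m (- J) = 1%:M by rewrite mulmxN JmxK opprK.
rewrite mxrankMfree ?row_free_unit //.
by have /eqP -> := frame_row_free; rewrite addnK.
Qed.

(** The normal space is spanned by the rows of E J, and the projection is the
    orthogonal one. *)
Lemma frame_second_ff i j : second_ff f i j x =
  partial i (partial j f) x *m (E *m J)^T *m (E *m J).
Proof.
rewrite /second_ff; set X := partial _ _ _; set N := Defs.normal_space f x.
have Esub : (E <= <<jacobian f x>>)%MS by rewrite genmxE frame_jacobian submxMl.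
have NJ : (E *m J <= N)%MS by rewrite sub_normal_space EJE.
have cap0 : (N :&: <<jacobian f x>>)%MS = 0.
  apply/eqP/rowV0P => w; rewrite sub_capmx genmxE => /andP[wN /submxP[u wu]].
  move: wN; rewrite sub_normal_space wu jacE -!mulmxA EE mulmx1 => /eqP e.
  by rewrite mulmxA e mul0mx.
have XE : X = X *m E^T *m E + X *m (E *m J)^T *m (E *m J).
  by rewrite -!mulmxA -mulmxDr frame_complete // mulmx1.
rewrite [in LHS]XE mulmxDl (proj_mx_0 cap0) ?mulmx_sub // add0r.
by rewrite (proj_mx_id cap0) //; apply: mulmx_sub.
Qed.
End Pointwise.
End FrameGeometry.

(** * From a Lagrangian frame to a Lagrangian immersion *)

Section FrameConclusions.
Context {R : realType} {n : nat} (W : set 'rV[R]_n) (oW : open W).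
Local Notation J := (Jmx R n).
Context (f : 'rV[R]_n -> 'rV[R]_(n + n)) (v : 'rV[R]_n -> 'rV[R]_n)
  (H : 'rV[R]_n -> 'M[R]_n) (E : 'rV[R]_n -> 'M[R]_(n, n + n)).
Hypothesis frE : lagrangian_frame W f v H E.
Hypothesis v0 : forall i x, W x -> v x 0 i != 0.

Let sf := frame_smooth_f frE.
Let sv := frame_smooth_v frE.

Lemma lagrangian_frame_jacobian x : W x -> jacobian f x = diag_mx (v x) *m E x.
Proof.
move=> Wx; apply/row_matrixP => i; rewrite row_jacobian; last exact: smooth_diff Wx.
have [_ ->//] := frame_f frE i.
by rewrite row_mul row_diag_mx -scalemxAl -rowE.
Qed.

Let jacE := lagrangian_frame_jacobian.
Let EE x (Wx : W x) := frame_orth frE Wx.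
Let EJE x (Wx : W x) := frame_lag frE Wx.

Lemma lagrangian_frame_metric x : W x ->
  induced_metric f x = diag_mx (\row_j v x 0 j ^+ 2).
Proof. by move=> Wx; rewrite (frame_metric (jacE Wx) (EE Wx)). Qed.

Lemma lagrangian_frame_isometric : isometric_immersion W (induced_metric f) f.
Proof.
split=> //; last first.
  split=> // x Wx; apply: (frame_row_free (jacE Wx)); last exact: EE.
  by move=> i; apply: v0.
split=> [|x Wx].
  have sg : smooth W (fun x => diag_mx (\row_j v x 0 j ^+ 2)).
    apply: smooth_mx => // a b.
    have sm : smooth W (fun x => (v x 0 b * v x 0 b) * (a == b)%:R).
      apply: smoothM (@smooth_cst _ _ _ _ _) => //.
      by apply: smoothM => //; apply: smooth_entry.
    apply: eq_smooth sm => // x _; rewrite !mxE mulr_natr expr2.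
    by case: eqP => [->|_].
  by apply: eq_smooth sg => // x Wx; rewrite lagrangian_frame_metric.
rewrite lagrangian_frame_metric //; split=> [|w w0]; first by rewrite tr_diag_mx.
have e : (w *m diag_mx (\row_j v x 0 j ^+ 2) *m w^T) 0 0 =
    \sum_j (w 0 j * v x 0 j) ^+ 2.
  rewrite mxE; apply: eq_bigr => j _.
  by rewrite mul_mx_diag !mxE exprMn expr2 mulrAC -!expr2 mulrAC.
rewrite e lt_def sumr_ge0 ?andbT; last by move=> j _; apply: sqr_ge0.
apply: contra_neq w0 => /eqP; rewrite psumr_eq0; last by move=> j _; apply: sqr_ge0.
move=> /allP s0; apply/rowP => j; have := s0 j (mem_index_enum j).
by rewrite /= sqrf_eq0 mulf_eq0 (negPf (v0 j Wx)) orbF mxE => /eqP.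
Qed.

Lemma lagrangian_frame_lagrangian : lagrangian W f.
Proof.
move=> x Wx; apply: (frame_is_lagrangian (jacE Wx)) => //.
- by move=> i; apply: v0.
- exact: EE.
- exact: EJE.
Qed.

(** Only the last term, v_j (D_i E J)_j, is normal to [f]. *)
Lemma second_partial_frame i j x : W x -> partial i (partial j f) x =
  partial i (fun y => v y 0 j) x *: row j (E x) +
  v x 0 j *: row j (connection (H x) i *m E x + delta_mx i i *m E x *m J).
Proof.
move=> Wx.
have hv := has_partialT i (smooth_entry 0 j oW sv).
have hrow := has_partial_mulmx oW
  (has_partial_cst W i (delta_mx 0 j : 'rV[R]_n)) (frame_E frE i).
have [_ e1] := has_partial_scale oW hv hrow.
have [_ e2] := frame_f frE j.
have e3 y : W y -> partial j f y = v y 0 j *: (delta_mx 0 j *m E y).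
  by move=> Wy; rewrite e2 // rowE.
apply: etrans (eq_partial i oW e3 Wx) _; apply: etrans (e1 x Wx) _.
by rewrite mul0mx add0r !rowE.
Qed.

Lemma lagrangian_frame_second_ff i j x : W x ->
  second_ff f i j x = (i == j)%:R *: (partial i f x *m J).
Proof.
move=> Wx; have v0x k := v0 k Wx.
rewrite (frame_second_ff (jacE Wx) v0x (EE Wx) (EJE Wx)).
have EJE2 : E x *m (E x *m J)^T = 0.
  by rewrite trmx_mul trJmx mulNmx mulmxN mulmxA EJE ?oppr0.
have EJJ : E x *m J *m (E x *m J)^T = 1%:M.
  by rewrite trmx_mul trJmx mulNmx mulmxN mulmxA -[E x *m J *m J]mulmxA JmxK
             mulmxN mulNmx opprK mulmx1 EE.
rewrite second_partial_frame // mulmxDl mulmxDl -!scalemxAl -!row_mul.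
rewrite mulmxDl -!mulmxA [E x *m (J *m _)]mulmxA EJE2 EJJ mulmx0 add0r mulmx1.
rewrite [E x *m (_ *m _)]mulmxA EJE2 mul0mx row0 scaler0 add0r.
have [_ ->//] := frame_f frE i.
case: (eqVneq i j) => [->|ij].
  by rewrite scale1r -scalemxAl rowE mulmxA mul_delta_mx -rowE row_mul.
rewrite scale0r rowE mulmxA mul_delta_mx_0 ?mul0mx ?scaler0 //.
by rewrite eq_sym.
Qed.

Hypothesis sysE : frame_system W v H.
Context (v' : 'I_n -> 'rV[R]_n -> R) (h' : 'I_n -> 'I_n -> 'rV[R]_n -> R).
Hypothesis vE : forall i x, W x -> v' i x = v x 0 i.
Hypothesis hE : forall i j x, W x -> i != j -> h' i j x = H x i j.

Let smooth_v' i : smooth W (v' i).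
Proof.
apply: eq_smooth (smooth_entry 0 i oW sv) => // x Wx.
by rewrite vE.
Qed.

Let smooth_h' i j : i != j -> smooth W (h' i j).
Proof.
move=> ij; apply: eq_smooth (smooth_entry i j oW (frame_smooth_H frE)) => // x Wx.
by rewrite hE.
Qed.

Let partial_v' i j x : W x -> partial i (v' j) x = partial i (fun y => v y 0 j) x.
Proof. by move=> Wx; exact: (@eq_partial R n W R i _ _ x oW (vE j) Wx). Qed.

Let partial_h' l i j x : W x -> i != j ->
  partial l (h' i j) x = partial l (fun y => H y i j) x.
Proof.
move=> Wx ij; have e y : W y -> h' i j y = H y i j by move=> Wy; apply: hE.
exact: (@eq_partial R n W R l _ _ x oW e Wx).
Qed.

Let Hsym i j x : W x -> H x i j = H x j i.
Proof. by move=> Wx; rewrite -[in LHS](frame_H_sym frE Wx) mxE. Qed.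

Lemma lagrangian_frame_pair : associated_pair W (induced_metric f) f v' h'.
Proof.
split.
- by move=> i; split=> // x Wx; rewrite vE // v0.
- move=> x Wx; rewrite lagrangian_frame_metric //; congr diag_mx.
  by apply/rowP => j; rewrite !mxE vE.
- by move=> i j x Wx; apply: lagrangian_frame_second_ff.
- move=> i j x Wx ij; have ji : j != i by rewrite eq_sym.
  rewrite !hE // [H x j i]Hsym //; split=> //.
  by rewrite vE // partial_v' // (system_v sysE) // mulrC mulfK ?v0 // Hsym.
Qed.

Lemma lagrangian_frame_solves : solves_system W v' h'.
Proof.
split.
- by split=> [i|i j ij] //; apply: smooth_h'.
- move=> i j x Wx ij; rewrite partial_v' // (system_v sysE) //.
  by rewrite vE // hE 1?eq_sym // Hsym.
- move=> i j x Wx ij.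
  apply: etrans (eq_bigr _ (fun l _ => partial_h' l Wx ij)) _.
  exact: (system_sum sysE Wx ij).
- move=> i j l x Wx li ij jl.
  apply: etrans (partial_h' l Wx ij) (etrans (system_h sysE Wx li ij jl) _).
  by rewrite !hE // eq_sym.
Qed.
End FrameConclusions.

(** * The Lagrangian frame of an immersion with principal coordinates *)

Section InitialFrame.

(** Here [a i j k] stands for the inner product of d_i E_j and E_k, and [D i j]
    for d_i v_j.  The hypotheses are that the connection is metric and that
    d_i (v_j E_j) = d_j (v_i E_i).  For distinct indices, v_j v_k a_ijk is
    symmetric in its first two indices and antisymmetric in the last two,
    hence zero; the other cases are read off directly. *)
Lemma koszul_unique (F : realFieldType) n (a : 'I_n -> 'I_n -> 'I_n -> F)
    (v : 'I_n -> F) (D H : 'I_n -> 'I_n -> F) :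
  (forall i, v i != 0) ->
  (forall i j k, a i j k = - a i k j) ->
  (forall i j k, D i j * (j == k)%:R + v j * a i j k =
                 D j i * (i == k)%:R + v i * a j i k) ->
  (forall i j, i != j -> D i j = v i * H i j) ->
  (forall i j, H i j = H j i) ->
  forall i j k, a i j k = H j i * (k == i)%:R - (j == i)%:R * H i k.
Proof.
move=> v0 anti rel DH Hsym.
have diag i j : a i j j = 0.
  by have := anti i j j; lra.
have key i j : j != i -> a i j i = H j i.
  move=> ji; have := rel j i i; rewrite eqxx diag (negPf ji) DH // !(mulr1, mulr0).
  by rewrite addr0 add0r => /(mulfI (v0 j)).
have tot0 i j k : i != j -> j != k -> k != i -> a i j k = 0.
  move=> ij jk ki.
  have swap p q r : p != q -> q != r -> r != p -> v q * a p q r = v p * a q p r.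
    move=> pq qr rp; have := rel p q r.
    by rewrite (negPf qr) [p == r]eq_sym (negPf rp) !mulr0 !add0r.
  have ik : i != k by rewrite eq_sym.
  have ji : j != i by rewrite eq_sym.
  have kj : k != j by rewrite eq_sym.
  have r1 := swap i j k ij jk ki; have r2 := swap i k j ik kj ji.
  have r3 := swap j k i jk ki ij.
  move: r1 r2 r3; rewrite (anti j k i) (anti k j i) (anti i k j) => r1 r2 r3.
  have e : v j * v k * a i j k = 0.
    have e1 : v j * v k * a i j k = v k * (v j * a i j k) by ring.
    have e2 : v j * v k * a i j k = - (v j * (v k * - a i j k)) by ring.
    have e3 : v k * (v i * a j i k) = - v i * (v k * - a j i k) by ring.
    have e4 : v j * (v i * a k i j) = - v i * (v j * - a k i j) by ring.
    by move: e1 e2; rewrite r1 r2 e3 e4 r3; lra.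
  by move/eqP: e; rewrite !mulf_eq0 (negPf (v0 j)) (negPf (v0 k)) => /eqP.
move=> i j k; case: (eqVneq j i) => [->|ji]; case: (eqVneq k i) => [->|ki].
- by rewrite diag mulr1 mul1r subrr.
- by rewrite anti key // mulr0 mul1r sub0r Hsym.
- by rewrite key // mulr1 mul0r subr0.
- rewrite mulr0 mul0r subrr; case: (eqVneq j k) => [->|jk]; first exact: diag.
  by apply: tot0 => //; rewrite eq_sym.
Qed.

Lemma row_comb_entry (F : comPzRingType) n m (E X : 'M[F]_(n, m)) c e q r :
  E *m E^T = 1%:M ->
  ((c *: row q E + e *: row q X) *m E^T) 0 r = c * (q == r)%:R + e * (X *m E^T) q r.
Proof.
move=> EE; rewrite mulmxDl -!scalemxAl -!row_mul EE addmxE.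
by congr (_ + _); rewrite mxE; congr (_ * _); rewrite !mxE.
Qed.

Context {R : realType} {n : nat} (W : set 'rV[R]_n) (oW : open W).
Local Notation J := (Jmx R n).
Context (g : 'rV[R]_n -> 'M[R]_n) (f : 'rV[R]_n -> 'rV[R]_(n + n))
  (v : 'I_n -> 'rV[R]_n -> R) (h : 'I_n -> 'I_n -> 'rV[R]_n -> R).
Hypothesis isoE : isometric_immersion W g f.
Hypothesis lagE : lagrangian W f.
Hypothesis pairE : associated_pair W g f v h.
Hypothesis sysE : solves_system W v h.

Definition pair_v x : 'rV[R]_n := \row_j v j x.
(** The diagonal of [pair_h] is set to zero, since that of [h] is arbitrary
    and need not be smooth. *)
Definition pair_h x : 'M[R]_n := \matrix_(i, j) (if i == j then 0 else h i j x).
Definition pair_e x : 'M[R]_(n, n + n) := \matrix_(j < n) frame f v j x.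

Let sf : smooth W f. Proof. by case: isoE => _ []. Qed.
Let sv i : smooth W (v i). Proof. by case: pairE => /(_ i)[]. Qed.
Let v0 i x : W x -> v i x != 0.
Proof. by case: pairE => /(_ i)[_ e] _ _ _; apply: e. Qed.

Let pair_v0 x : W x -> forall i, pair_v x 0 i != 0.
Proof. by move=> Wx i; rewrite mxE v0. Qed.

Let sE : smooth W pair_e.
Proof.
apply: smooth_mx => // a b.
have sm : smooth W (fun x => (v a x)^-1 * partial a f x 0 b).
  apply: smoothM => //; first by apply: smoothV => // x; apply: v0.
  by apply: smooth_entry => //; apply: smooth_partial.
by apply: eq_smooth sm => // x _; rewrite !mxE.
Qed.

Let fE i x : W x -> partial i f x = v i x *: row i (pair_e x).
Proof. by move=> Wx; rewrite rowK /frame scalerA mulfV ?v0 // scale1r. Qed.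

Let jacE x : W x -> jacobian f x = diag_mx (pair_v x) *m pair_e x.
Proof.
move=> Wx; apply/row_matrixP => i; rewrite row_jacobian; last exact: smooth_diff Wx.
by rewrite fE // row_mul row_diag_mx -scalemxAl -rowE mxE.
Qed.

Let EE x : W x -> pair_e x *m (pair_e x)^T = 1%:M.
Proof.
move=> Wx; have [_ _ /(_ x Wx)] := isoE; have [_ /(_ x Wx) -> _ _] := pairE.
have Du := unit_diag (pair_v0 Wx).
rewrite /induced_metric jacE // trmx_mul tr_diag_mx => e.
apply: (can_inj (mulKmx Du)); apply: (can_inj (mulmxK Du)).
rewrite mulmx1 mulmx_diag.
transitivity (diag_mx (pair_v x) *m pair_e x
  *m ((pair_e x)^T *m diag_mx (pair_v x))).
  by rewrite !mulmxA.
by rewrite e; congr diag_mx; apply/rowP => j; rewrite !mxE expr2.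
Qed.

Let EJE x : W x -> pair_e x *m J *m (pair_e x)^T = 0.
Proof.
move=> Wx; have /andP [le _] := lagE Wx; have Du := unit_diag (pair_v0 Wx).
move: le; rewrite (sub_normal_space (jacE Wx) (pair_v0 Wx)).
rewrite jacE // -!mulmxA => /eqP e.
by apply: (can_inj (mulKmx Du)); rewrite mulmx0 -[RHS]e !mulmxA.
Qed.

Let Hsym i j x : W x -> pair_h x i j = pair_h x j i.
Proof.
move=> Wx; rewrite !mxE eq_sym; case: eqVneq => // ji.
by have [_ _ _ /(_ j i x Wx ji)[]] := pairE.
Qed.

Let partial_vE i j x : W x -> i != j -> partial i (v j) x = v i x * pair_h x i j.
Proof.
move=> Wx ij; rewrite mxE (negPf ij).
by have [_ _ _ /(_ i j x Wx ij)[_ ->]] := pairE; rewrite mulrA mulfV ?v0 // mul1r.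
Qed.

Let second_partial_f i j x : W x -> partial i (partial j f) x =
  partial i (v j) x *: row j (pair_e x) + v j x *: row j (partial i pair_e x).
Proof.
move=> Wx.
have hrow := has_partial_mulmx oW (has_partial_cst W i (delta_mx 0 j : 'rV[R]_n))
  (has_partialT i sE).
have [_ e1] := has_partial_scale oW (has_partialT i (sv j)) hrow.
have e3 y : W y -> partial j f y = v j y *: (delta_mx 0 j *m pair_e y).
  by move=> Wy; rewrite fE // rowE.
apply: etrans (eq_partial i oW e3 Wx) _; apply: etrans (e1 x Wx) _.
by rewrite mul0mx add0r !rowE.
Qed.

Let tangential i x : W x ->
  partial i pair_e x *m (pair_e x)^T = connection (pair_h x) i.
Proof.
move=> Wx; apply/matrixP => j k.
pose a p q r := (partial p pair_e x *m (pair_e x)^T) q r.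
rewrite connectionE.
apply: (@koszul_unique _ _ a (fun p => v p x) (fun p q => partial p (v q) x)
  (fun p q => pair_h x p q)) => [p|p q r|p q r|p q pq|p q].
- exact: v0.
- have hE := has_partialT p sE.
  have [_ e1] := has_partial_mulmx oW hE (has_partial_trmx oW hE).
  have [_ e0] : has_partial W p (fun x => pair_e x *m (pair_e x)^T) (fun=> 0).
    by apply: eq_has_partial (has_partial_cst W p 1%:M) _ _ => // y /EE.
  have /matrixP /(_ q r) := etrans (esym (e0 x Wx)) (e1 x Wx).
  rewrite [RHS]addmxE [LHS]mxE => /esym /eqP; rewrite addr_eq0 => /eqP e.
  rewrite /a e; congr (- _).
  transitivity ((pair_e x *m (partial p pair_e x)^T)^T r q); first by rewrite [RHS]mxE.
  by rewrite trmx_mul trmxK.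
- have e : partial p (partial q f) x *m (pair_e x)^T =
           partial q (partial p f) x *m (pair_e x)^T.
    exact: (congr1 (fun z => z *m (pair_e x)^T) (partial_comm_mx oW p q sf Wx)).
  have key s t := @row_comb_entry R _ _ (pair_e x) (partial s pair_e x)
    (partial s (v t) x) (v t x) t r (EE Wx).
  apply: etrans (esym (key p q)) (etrans _ (key q p)).
  apply: (congr1 (fun z : 'rV[R]_n => z 0 r)).
  apply: etrans (congr1 (fun z => z *m (pair_e x)^T)
    (esym (second_partial_f p q Wx))) _.
  exact: etrans e (congr1 (fun z => z *m (pair_e x)^T) (second_partial_f q p Wx)).
- exact: partial_vE.
- exact: Hsym.
Qed.

Let normal i x : W x ->
  partial i pair_e x *m (pair_e x *m J)^T = delta_mx i i.
Proof.
move=> Wx; apply/row_matrixP => j; have EEx := EE Wx; have EJEx := EJE Wx.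
have EJE2 : pair_e x *m (pair_e x *m J)^T = 0.
  by rewrite trmx_mul trJmx mulNmx mulmxN mulmxA EJEx oppr0.
have EJJ : pair_e x *m J *m (pair_e x *m J)^T = 1%:M.
  by rewrite trmx_mul trJmx mulNmx mulmxN mulmxA -[_ *m J *m J]mulmxA JmxK
             mulmxN mulNmx opprK mulmx1.
have [_ _ /(_ i j x Wx) e _] := pairE.
have := congr1 (fun z => z *m (pair_e x *m J)^T) (etrans
  (esym (frame_second_ff (jacE Wx) (pair_v0 Wx) EEx EJEx i j)) e).
rewrite /= -[_ *m (_ *m J) *m _]mulmxA EJJ mulmx1.
move=> /(etrans (congr1 (fun z => z *m _) (esym (second_partial_f i j Wx)))).
rewrite fE // mulmxDl -!scalemxAl -!row_mul EJE2 row0 scaler0 add0r.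
rewrite EJJ => e2; apply: (scalerI (v0 j Wx)); rewrite [LHS]e2.
rewrite !rowE mulmx1; case: (eqVneq i j) => [->|ij].
  by rewrite scale1r mul_delta_mx.
by rewrite scale0r mul_delta_mx_0 ?scaler0 // eq_sym.
Qed.

(** The derivative of the frame is decomposed on the orthonormal basis made of
    E and E J: [tangential] and [normal] compute the two parts. *)
Lemma pair_lagrangian_frame : lagrangian_frame W f pair_v pair_h pair_e.
Proof.
have [[_ shE] _ _ _] := sysE.
split=> //.
- apply: smooth_mx => // a b.
  by apply: eq_smooth (sv b) => // x _; rewrite mxE.
- apply: smooth_mx => // a b; case: (eqVneq a b) => ab.
    by apply: eq_smooth (@smooth_cst _ _ W R 0) => // x _; rewrite mxE ab eqxx.
  by apply: eq_smooth (shE a b ab) => // x _; rewrite mxE (negPf ab).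
- by move=> x Wx; apply/matrixP => i j; rewrite mxE Hsym.
- by move=> i; split=> // x Wx; rewrite fE // mxE.
move=> i; split=> // x Wx.
rewrite -[LHS]mulmx1 -(frame_complete (EE Wx) (EJE Wx)) mulmxDr !mulmxA.
by rewrite tangential // -!mulmxA mulmxA normal.
Qed.

Lemma pair_frame_system : frame_system W pair_v pair_h.
Proof.
have [_ s1 s2 s3] := sysE.
have hE i j : i != j -> (fun y => pair_h y i j) = h i j.
  by move=> ij; apply/funext => y; rewrite mxE (negPf ij).
split.
- move=> i j x Wx ij; have -> : (fun y => pair_v y 0 i) = v i.
    by apply/funext => y; rewrite mxE.
  by rewrite s1 // Hsym // !mxE eq_sym (negPf ij).
- by move=> i j x Wx ij; rewrite hE //; apply: s2.
- move=> i j l x Wx li ij jl; rewrite hE // (s3 _ _ _ _ Wx li ij jl).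
  by rewrite !mxE [i == l]eq_sym (negPf li) (negPf jl).
Qed.
End InitialFrame.

(** * Flatness *)

Section Flatness.

Lemma sum_deltal (F : pzSemiRingType) n (i : 'I_n) (a : 'I_n -> F) :
  \sum_m (i == m)%:R * a m = a i.
Proof.
rewrite (bigD1 i) //= eqxx mul1r big1 ?addr0 // => m.
by rewrite eq_sym => /negPf ->; rewrite mul0r.
Qed.

Lemma sum_deltar (F : pzSemiRingType) n (i : 'I_n) (a : 'I_n -> F) :
  \sum_m a m * (m == i)%:R = a i.
Proof.
rewrite (bigD1 i) //= eqxx mulr1 big1 ?addr0 // => m.
by move=> /negPf ->; rewrite mulr0.
Qed.

(** The curvature form of the connection omega vanishes.  Here [e] stands for
    the h_ij with zero diagonal, [d l] for its derivative along d_l.  An entry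
    of the curvature form involves, according to the coincidences between
    k, l and i, j, the equation for d_l h_ij with distinct indices or the one
    for the sum; in the latter the terms with l distinct from i and j are
    products h_il h_jl. *)
Lemma structure_equation (F : comPzRingType) n (e : 'I_n -> 'I_n -> F)
    (d : 'I_n -> 'I_n -> 'I_n -> F) :
  (forall a b, e a b = e b a) -> (forall a, e a a = 0) ->
  (forall i a b, d i a b = d i b a) -> (forall i a, d i a a = 0) ->
  (forall i a b, i != a -> a != b -> b != i -> d i a b = e a i * e b i) ->
  (forall i j, i != j -> \sum_l d l i j = 0) ->
  forall i j k l,
  let c p q r := e q p * (r == p)%:R - (q == p)%:R * e p r in
  let dc s p q r := d s q p * (r == p)%:R - (q == p)%:R * d s p r in
  dc i j k l - dc j i k l + \sum_m (c i m l * c j k m - c j m l * c i k m) = 0.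
Proof.
move=> es e0 ds d0 d1 dsum i j k l c dc.
case: (eqVneq i j) => [->|ij].
  by rewrite subrr add0r big1 // => m _; rewrite subrr.
have sym (a b : 'I_n) : a != b -> b != a by rewrite eq_sym.
have ji := sym _ _ ij.
have dsum2 : d i i j + d j i j + \sum_m e i m * e j m = 0.
  rewrite -[RHS](dsum i j ij) (bigD1 i) //= (bigD1 j) //= [in RHS](bigD1 i) //=.
  rewrite [in RHS](bigD1 j) //= e0 mul0r e0 mulr0 !add0r addrA; congr (_ + _).
  apply: eq_bigr => m /andP[mi mj]; rewrite d1 // eq_sym //.
have cc p q : p != q -> \sum_m c p m l * c q k m =
    (l == p)%:R * (e k q * e q p) + (k == q)%:R * (e q p * e p l)
    - (k == q)%:R * (l == p)%:R * \sum_m e p m * e q m.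
  move=> pq; rewrite /c.
  transitivity (\sum_m (((l == p)%:R * e k q * e m p) * (m == q)%:R
    + (p == m)%:R * ((k == q)%:R * e q m * e p l)
    - (k == q)%:R * (l == p)%:R * (e p m * e q m)
    - (p == m)%:R * (e p l * e k q * (m == q)%:R))).
    by apply: eq_bigr => m _; rewrite [p == m]eq_sym [e p m]es; ring.
  rewrite !(sumrB, big_split) /= sum_deltar !sum_deltal -mulr_sumr (negPf pq) /=.
  by ring.
rewrite sumrB cc // cc // /dc.
have -> : \sum_m e j m * e i m = \sum_m e i m * e j m.
  by apply: eq_bigr => m _; rewrite mulrC.
move: (\sum_m _) dsum2 => Sg dsum2.
have SgE : Sg = - d i i j - d j i j.
  transitivity ((d i i j + d j i j + Sg) - d i i j - d j i j); first by ring.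
  by rewrite dsum2 sub0r.
case: (eqVneq l j) => [->|lj]; rewrite ?(negPf ij) ?(negPf ji).
  case: (eqVneq k j) => [->|kj]; rewrite ?(negPf ji) ?d0 ?e0.
    by rewrite (es j i); rewrite /=; ring.
  case: (eqVneq k i) => [->|ki]; rewrite ?eqxx ?e0.
    by rewrite SgE (es j i); rewrite /=; ring.
  by rewrite (d1 _ _ _ (sym _ _ ki) kj ji) (es j i); rewrite /=; ring.
case: (eqVneq l i) => [->|li].
  case: (eqVneq k j) => [->|kj]; rewrite ?(negPf ji) ?e0 ?eqxx.
    by rewrite SgE (ds i j i) (ds j j i) (es j i); rewrite /=; ring.
  case: (eqVneq k i) => [->|ki]; rewrite ?eqxx ?e0 ?d0.
    by rewrite (es j i); rewrite /=; ring.
  by rewrite (d1 _ _ _ (sym _ _ kj) ki ij) (es j i); rewrite /=; ring.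
case: (eqVneq k j) => [->|kj]; rewrite ?(negPf ji).
  by rewrite (d1 _ _ _ ij (sym _ _ lj) li) (es l i); rewrite /=; ring.
case: (eqVneq k i) => [->|ki]; last by rewrite /=; ring.
by rewrite (d1 _ _ _ ji (sym _ _ li) lj) (es l j); rewrite /=; ring.
Qed.

Lemma eq_subr_of_add (V : zmodType) (a b c : V) : a + b = c -> b = c - a.
Proof. by move=> <-; rewrite addrAC subrr add0r. Qed.

Lemma product_combine (F : comPzRingType) (vl vm vk Gl Gm c1 c2 dl dm Pl Dm : F) :
  vl * Gl = c1 * vm + dl * Pl -> vm * Gm = c2 * vk + dm * Dm ->
  vl * (Gl * Gm) = vk * (c1 * c2) + c1 * Dm * dm + dl * (Pl * Gm).
Proof.
move=> el em; rewrite mulrA el; transitivity (c1 * (vm * Gm) + dl * (Pl * Gm)).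
  by ring.
by rewrite em; ring.
Qed.

Lemma curvature_combine (F : comPzRingType) (vl vk a b S1 S2 dc1 dc2 cj ci Di Dj
    Pi Pj Gj Gi dlk X1 X2 s1 s2 : F) :
  vl * a = dc1 * vk + cj * Di + dlk * X1 - Pi * Gj ->
  vl * b = dc2 * vk + ci * Dj + dlk * X2 - Pj * Gi ->
  vl * S1 = vk * s1 + ci * Dj + Pi * Gj ->
  vl * S2 = vk * s2 + cj * Di + Pj * Gi ->
  X1 = X2 -> dc1 - dc2 + (s1 - s2) = 0 ->
  vl * (a - b + (S1 - S2)) = 0.
Proof.
move=> p1 p2 c1 c2 eX se; rewrite mulrDr !mulrBr p1 p2 c1 c2 eX.
by transitivity (vk * (dc1 - dc2 + (s1 - s2))); [ring | rewrite se mulr0].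
Qed.

Context {R : realType} {n : nat} (W : set 'rV[R]_n) (oW : open W).
Context (g : 'rV[R]_n -> 'M[R]_n) (v : 'rV[R]_n -> 'rV[R]_n)
  (H : 'rV[R]_n -> 'M[R]_n).
Hypothesis sv : smooth W v.
Hypothesis sH : smooth W H.
Hypothesis v0 : forall i x, W x -> v x 0 i != 0.
Hypothesis Hsym : forall x i j, W x -> H x i j = H x j i.
Hypothesis Hdiag : forall x i, W x -> H x i i = 0.
Hypothesis sysE : frame_system W v H.
Hypothesis gE : forall x, W x -> g x = diag_mx (\row_j v x 0 j ^+ 2).

Local Notation D i j := (partial i (fun y => v y 0 j)).

Let smooth_v j : smooth W (fun y => v y 0 j). Proof. exact: smooth_entry. Qed.

Let partial_vE i j x : W x -> i != j -> D i j x = H x i j * v x 0 i.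
Proof. by move=> Wx ij; rewrite (system_v sysE Wx) 1?eq_sym // Hsym. Qed.

Let partial_metric i j k x : W x ->
  partial i (fun y => g y j k) x = (j == k)%:R * (2 * v x 0 j * D i j x).
Proof.
move=> Wx; have hv := has_partialT i (smooth_v j).
have [_ e] : has_partial W i (fun y => g y j k)
    (fun y => (j == k)%:R * (2 * v y 0 j * D i j y)).
  apply: (eq_has_partial oW
    (has_partialZ oW (j == k)%:R (has_partialM oW hv hv))) => y Wy.
    rewrite gE // !mxE; case: eqP => [->|_]; last by rewrite mul0r mulr0n.
    by rewrite mul1r mulr1n expr2.
  by ring.
exact: e.
Qed.

Let christoffelE k i j x : W x -> christoffel g k i j x =
  (v x 0 k)^-1 * (connection (H x) i j k * v x 0 j + (k == j)%:R * D i k x).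
Proof.
move=> Wx; rewrite /christoffel.
have gV : invmx (g x) = diag_mx (\row_l (v x 0 l)^-1 ^+ 2).
  have e : diag_mx (\row_l (v x 0 l)^-1 ^+ 2) *m g x = 1%:M.
    rewrite gE // mulmx_diag; apply/matrixP => a b; rewrite !mxE.
    by rewrite -exprMn mulVf ?v0 // expr1n.
  have [_ gu] := mulmx1_unit e.
  by rewrite -[LHS]mul1mx -e mulmxK.
transitivity (2^-1 * \sum_l (k == l)%:R * ((v x 0 k)^-1 ^+ 2 *
   ((j == l)%:R * (2 * v x 0 j * D i j x) + (i == l)%:R * (2 * v x 0 i * D j i x)
    - (i == j)%:R * (2 * v x 0 i * D l i x)))).
  congr (_ * _); apply: eq_bigr => l _; rewrite !partial_metric // gV !mxE.
  by rewrite -[_ *+ (k == l)]mulr_natl -[LHS]mulrA.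
rewrite sum_deltal connectionE.
have vk := v0 k Wx.
case: (eqVneq j i) => [->|ji]; last first.
  have ij : i != j by rewrite eq_sym.
  case: (eqVneq k i) => [->|ki].
    rewrite ?(negPf ji, negPf ij) (partial_vE Wx ji) /=.
    by field; rewrite v0.
  have ik : i != k by rewrite eq_sym.
  rewrite ?(negPf ki, negPf ik) /=.
  by case: (eqVneq j k) => [->|jk] /=; field; rewrite vk.
case: (eqVneq k i) => [->|ki].
  by rewrite ?eqxx Hdiag //=; field; rewrite v0 //= two.
have ik : i != k by rewrite eq_sym.
rewrite ?(negPf ki, negPf ik) (partial_vE Wx ki) (Hsym i k Wx) /=.
by field; rewrite vk.
Qed.

(* The formula of [christoffelE] as a function; multiplied by v_k it can be
   differentiated without differentiating an inverse. *)
Let G k i j x :=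
  (v x 0 k)^-1 * (connection (H x) i j k * v x 0 j + (k == j)%:R * D i k x).

Let smooth_connection i j k : smooth W (fun x => connection (H x) i j k).
Proof.
have s : smooth W (fun x => H x j i * (k == i)%:R - (j == i)%:R * H x i k).
  apply: smoothB => //; apply: smoothM => //; try exact: smooth_entry;
    exact: smooth_cst.
by apply: eq_smooth s => // x _; rewrite connectionE.
Qed.

Let smooth_G k i j : smooth W (G k i j).
Proof.
apply: smoothM => //; first by apply: smoothV => // x; apply: v0.
apply: smoothD => //; first exact: smoothM.
by apply: smoothM => //; [exact: smooth_cst | exact: smooth_partial].
Qed.

Let mul_v_G k i j x : W x -> v x 0 k * G k i j x =
  connection (H x) i j k * v x 0 j + (k == j)%:R * D i k x.
Proof. by move=> Wx; rewrite /G mulrA mulfV ?v0 // mul1r. Qed.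

Let partial_connection s i j k x : W x ->
  partial s (fun y => connection (H y) i j k) x =
  partial s (fun y => H y j i) x * (k == i)%:R
  - (j == i)%:R * partial s (fun y => H y i k) x.
Proof.
move=> Wx.
have hH a b := has_partialT s (smooth_entry a b oW sH).
have [_ e] : has_partial W s (fun y => connection (H y) i j k)
    (fun y => partial s (fun y => H y j i) y * (k == i)%:R
      - (j == i)%:R * partial s (fun y => H y i k) y).
  apply: (eq_has_partial oW (has_partialB oW (has_partialZ oW (k == i)%:R (hH j i))
    (has_partialZ oW (j == i)%:R (hH i k)))) => y Wy.
    by rewrite connectionE mulrC.
  by rewrite mulrC.
exact: e.
Qed.

Let partial_G s k i j x : W x -> v x 0 k * partial s (G k i j) x =
  partial s (fun y => connection (H y) i j k) x * v x 0 j
  + connection (H x) i j k * D s j x + (k == j)%:R * partial s (D i k) x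
  - D s k x * G k i j x.
Proof.
move=> Wx.
have [_ e1] := has_partialM oW (has_partialT s (smooth_v k))
  (has_partialT s (smooth_G k i j)).
have [_ e2] := has_partialD oW
  (has_partialM oW (has_partialT s (smooth_connection i j k))
    (has_partialT s (smooth_v j)))
  (has_partialZ oW (k == j)%:R
     (has_partialT s (smooth_partial i (smooth_v k)))).
have FG y : W y -> v y 0 k * G k i j y =
  connection (H y) i j k * v y 0 j + (k == j)%:R * D i k y by apply: mul_v_G.
have e := etrans (esym (e1 x Wx))
  (etrans (@eq_partial R n W R s _ _ x oW FG Wx) (e2 x Wx)).
exact: eq_subr_of_add e.
Qed.

(** The Christoffel symbols come from the connection omega by the gauge
    transformation diag(v), so the curvature is conjugate to that of omega,
    plus diag(v)^-1 (d_i d_j - d_j d_i) diag(v) = 0. *)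
Lemma principal_metric_flat : flat W g.
Proof.
move=> l k i j x Wx; rewrite /curvature.
have FG a b c y : W y -> christoffel g a b c y = G a b c y by apply: christoffelE.
have E1 : partial i (christoffel g l j k) x = partial i (G l j k) x.
  exact: (@eq_partial R n W R i _ _ x oW (FG l j k) Wx).
have E2 : partial j (christoffel g l i k) x = partial j (G l i k) x.
  exact: (@eq_partial R n W R j _ _ x oW (FG l i k) Wx).
have cG p q : v x 0 l * \sum_m G l p m x * G m q k x =
    v x 0 k * \sum_m connection (H x) p m l * connection (H x) q k m
    + connection (H x) p k l * D q k x + D p l x * G l q k x.
  rewrite [LHS]mulr_sumr.
  transitivity (\sum_m (v x 0 k * (connection (H x) p m l * connection (H x) q k m)
     + connection (H x) p m l * D q m x * (m == k)%:R
     + (l == m)%:R * (D p l x * G m q k x))).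
    apply: eq_bigr => m _.
    exact: product_combine (mul_v_G l p m Wx) (mul_v_G m q k Wx).
  by rewrite !big_split /= sum_deltal sum_deltar -mulr_sumr.
have E3 : \sum_m (christoffel g l i m x * christoffel g m j k x
      - christoffel g l j m x * christoffel g m i k x) =
    \sum_m G l i m x * G m j k x - \sum_m G l j m x * G m i k x.
  by rewrite -sumrB; apply: eq_bigr => m _; rewrite !FG.
apply: etrans (congr2 +%R (congr2 (fun a b => a - b) E1 E2) E3) _.
apply: (mulfI (v0 l Wx)); rewrite [RHS]mulr0.
have comm : partial i (D j l) x = partial j (D i l) x.
  exact: (partial_comm oW i j (smooth_v l) Wx).
have es a b : H x a b = H x b a by apply: Hsym.
have e0 a : H x a a = 0 by apply: Hdiag.
have ds s a b : partial s (fun y => H y a b) x = partial s (fun y => H y b a) x.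
  have FGs y : W y -> H y a b = H y b a by apply: Hsym.
  exact: (@eq_partial R n W R s _ _ x oW FGs Wx).
have d0 s a : partial s (fun y => H y a a) x = 0.
  have FG0 y : W y -> H y a a = 0 by apply: Hdiag.
  apply: etrans (@eq_partial R n W R s _ (fun=> 0) x oW FG0 Wx) _.
  exact: derive_cst.
have cS : \sum_m connection (H x) i m l * connection (H x) j k m
    - \sum_m connection (H x) j m l * connection (H x) i k m =
  \sum_m ((H x m i * (l == i)%:R - (m == i)%:R * H x i l)
            * (H x k j * (m == j)%:R - (k == j)%:R * H x j m)
         - (H x m j * (l == j)%:R - (m == j)%:R * H x j l)
            * (H x k i * (m == i)%:R - (k == i)%:R * H x i m)).
  by rewrite -sumrB; apply: eq_bigr => m _; rewrite !connectionE.
have se := etrans (congr2 +%R (congr2 (fun a b => a - b)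
    (partial_connection i j k l Wx) (partial_connection j i k l Wx)) cS)
  (structure_equation es e0 ds d0 (fun s a b => system_h sysE Wx)
    (fun a b => system_sum sysE Wx) i j k l).
exact: curvature_combine (partial_G i l j k Wx) (partial_G j l i k Wx)
  (cG i j) (cG j i) comm se.
Qed.
End Flatness.

(** The structure equations need a vanishing diagonal; this replaces the
    diagonal of [H] by zero. *)
Lemma lagrangian_frame_flat (R : realType) (n : nat) (W : set 'rV[R]_n)
    (f : 'rV[R]_n -> 'rV[R]_(n + n)) (v : 'rV[R]_n -> 'rV[R]_n)
    (H : 'rV[R]_n -> 'M[R]_n) (E : 'rV[R]_n -> 'M[R]_(n, n + n)) :
  open W -> lagrangian_frame W f v H E -> (forall i x, W x -> v x 0 i != 0) ->
  frame_system W v H -> flat W (induced_metric f).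
Proof.
move=> oW frE v0 sysE.
pose H0 x : 'M[R]_n := \matrix_(i, j) (if i == j then 0 else H x i j).
have H0E i j : i != j -> (fun y => H0 y i j) = (fun y => H y i j).
  by move=> /negPf ij; apply/funext => y; rewrite mxE ij.
have H0x i j x : i != j -> H0 x i j = H x i j.
  by move=> /negPf ij; rewrite mxE ij.
apply: (@principal_metric_flat _ _ W oW _ v H0) => //.
- exact: frame_smooth_v frE.
- apply: smooth_mx => // a b; case: (eqVneq a b) => ab.
    by apply: eq_smooth (@smooth_cst _ _ W R 0) => // x _; rewrite mxE ab eqxx.
  by rewrite H0E //; apply: smooth_entry => //; exact: frame_smooth_H frE.
- move=> x i j Wx; rewrite !mxE eq_sym; case: eqP => // _.
  by rewrite -[in LHS](frame_H_sym frE Wx) mxE.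
- by move=> x i _; rewrite mxE eqxx.
- split.
  + by move=> i j x Wx ij; rewrite (system_v sysE) // H0x.
  + by move=> i j x Wx ij; rewrite H0E //; exact: (system_sum sysE Wx ij).
  + move=> i j l x Wx li ij jl; rewrite H0E // !H0x //; last by rewrite eq_sym.
    exact: (system_h sysE).
- by move=> x Wx; rewrite (lagrangian_frame_metric frE).
Qed.

(** * The linear system and the main theorem *)

Section LinearSystem.
Context {R : realType} {n d : nat} (W : set 'rV[R]_n) (oW : open W).
Context (g : 'rV[R]_n -> 'M[R]_n) (f : 'rV[R]_n -> 'rV[R]_(n + n))
  (v : 'I_n -> 'rV[R]_n -> R) (h : 'I_n -> 'I_n -> 'rV[R]_n -> R)
  (P : 'M[R]_d) (phi : 'rV[R]_n -> 'cV[R]_d)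
  (gamma : 'I_n -> 'rV[R]_n -> 'cV[R]_d) (Omega : 'rV[R]_n -> 'M[R]_d).
Hypothesis pairE : associated_pair W g f v h.
Hypothesis linE : solves_linear_system W v h P phi gamma.

(** Columns are turned into rows, to match the rows of the frame. *)
Definition gamma_mx x : 'M[R]_(n, d) := \matrix_(i < n) (gamma i x)^T.
Definition phi_row x : 'rV[R]_d := (phi x)^T.

Lemma smooth_gamma_mx : smooth W gamma_mx.
Proof.
have [[_ sg] _ _ _] := linE; apply: smooth_mx => // a b.
by apply: eq_smooth (smooth_entry b 0 oW (sg a)) => // x _; rewrite !mxE.
Qed.

Lemma smooth_phi_row : smooth W phi_row.
Proof. by have [[sp _] _ _ _] := linE; apply: smooth_trmx. Qed.

Lemma phi_row_partial i :
  has_partial W i phi_row (fun x => pair_v v x 0 i *: row i (gamma_mx x)).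
Proof.
have [[sp _] dp _ _] := linE.
apply: (eq_has_partial oW (has_partial_trmx oW (has_partialT i sp))) => // x Wx.
by rewrite rowK mxE; apply: etrans (congr1 trmx (dp i x Wx)) _; apply: linearZ.
Qed.

Lemma gamma_mx_partial i : has_partial W i gamma_mx
  (fun x => connection (pair_h h x) i *m gamma_mx x
            - delta_mx i i *m gamma_mx x *m invmx P).
Proof.
have [[_ sg] _ dii dij] := linE.
apply: has_partial_mx => // a b.
apply: (eq_has_partial oW (has_partial_entry oW b 0 (has_partialT i (sg a)))).
  by move=> x Wx; rewrite !mxE.
move=> x Wx; rewrite addmxE oppmxE -mulmxA.
case: (eqVneq a i) => [->|ai]; last first.
  rewrite connection_mull // delta_diag_mull // subr0.
  apply: etrans (congr1 (fun z : 'cV[R]_d => z b 0) (dij i a x Wx ai)) _.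
  have [_ _ _ /(_ a i x Wx ai)[hE _]] := pairE.
  by rewrite !mxE (negPf ai) hE.
apply: etrans (congr1 (fun z : 'cV[R]_d => z b 0) (dii i x Wx)) _.
rewrite addmxE !oppmxE addrC; congr (_ - _); last first.
  rewrite -[delta_mx i i]mul1mx mul_delta_diag [1%:M i i]mxE eqxx mul1r.
  transitivity (((gamma_mx x *m invmx P)^T) b i); last by rewrite [LHS]mxE.
  rewrite trmx_mul trmx_inv [LHS]mxE [RHS]mxE; apply: eq_bigr => k _.
  by congr (_ * _); rewrite !mxE.
rewrite /connection mulmxBl addmxE oppmxE mul_delta_diag [pair_h h x i i]mxE.
rewrite eqxx mul0r add0r.
congr (- _); rewrite -mulmxA -[delta_mx i i]mul1mx mul_delta_diag [1%:M i i]mxE.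
rewrite eqxx mul1r summxE [RHS]mxE [RHS](bigD1 i) //= [pair_h h x i i]mxE.
rewrite eqxx mul0r add0r.
by apply: eq_bigr => j ji; rewrite !mxE eq_sym (negPf ji).
Qed.

(** With D = diag(v), the matrix of d phi is T^t D and the metric is D^2. *)
Lemma gram_diff x : W x ->
  diff_mx phi x *m adj_diff_mx g phi x = (gamma_mx x)^T *m gamma_mx x.
Proof.
move=> Wx; have [[sp _] dp _ _] := linE.
have [v0 /(_ x Wx) gE _ _] := pairE.
have Du : diag_mx (pair_v v x) \in unitmx.
  by apply: unit_diag => i; rewrite mxE; have [_ ->] := v0 i.
have gDD : g x = diag_mx (pair_v v x) *m diag_mx (pair_v v x).
  by rewrite gE mulmx_diag; congr diag_mx; apply/rowP => j; rewrite !mxE expr2.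
have dE : diff_mx phi x = (gamma_mx x)^T *m diag_mx (pair_v v x).
  apply/matrixP => k i; rewrite mul_mx_diag !mxE mulrC.
  have dx : differentiable phi x by apply: smooth_diff Wx.
  have e := etrans (esym (deriveE (delta_mx 0 i) dx)) (dp i x Wx).
  by apply: etrans (congr1 (fun z : 'cV[R]_d => z k 0) e) _; rewrite mxE.
have gu : g x \in unitmx by rewrite gDD unitmx_mul Du.
rewrite /adj_diff_mx dE trmx_mul trmxK tr_diag_mx; move: gDD gu Du.
move: (diag_mx _) (g x) => D g0 gDD gu Du.
have e : D *m invmx g0 *m D = 1%:M.
  apply: (can_inj (mulKmx Du)); rewrite !mulmxA -gDD mulmx1.
  by rewrite mulmxV // mul1mx.
transitivity ((gamma_mx x)^T *m (D *m invmx g0 *m D) *m gamma_mx x).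
  by rewrite !mulmxA.
by rewrite e mulmx1.
Qed.

Lemma inner_gamma (w : 'cV[R]_d) j x :
  inner w (gamma j x) = (w^T *m (gamma_mx x)^T) 0 j.
Proof. by rewrite mxE; apply: eq_bigr => k _; rewrite !mxE. Qed.

Lemma innerC (a b : 'cV[R]_d) : inner a b = inner b a.
Proof. by apply: eq_bigr => k _; rewrite mulrC. Qed.

Local Notation S x := ((P + invmx P) *m invmx (Omega x)).

(** The symmetry of the dressing matrix, which holds on W only, turns the
    inner products of the definition into those of the matrix form. *)
Lemma transform_v_dressed i x : (S x)^T = S x ->
  transform_v v P phi gamma Omega i x =
  dressed_v P (pair_v v) phi_row gamma_mx Omega x 0 i.
Proof.
move=> Ssym; rewrite /transform_v /dressed_v addmxE [pair_v v x 0 i]mxE.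
congr (_ + _); rewrite innerC inner_gamma.
have -> : ((P + invmx P) *m (invmx (Omega x) *m phi x))^T = phi_row x *m S x.
  by rewrite [_ *m (_ *m phi x)]mulmxA trmx_mul Ssym.
by [].
Qed.

Lemma transform_h_dressed i j x : i != j -> (S x)^T = S x ->
  transform_h h P gamma Omega i j x = dressed_h P (pair_h h) gamma_mx Omega x i j.
Proof.
move=> /negPf ij Ssym; rewrite /transform_h /dressed_h addmxE.
rewrite [pair_h h x i j]mxE ij; congr (_ + _).
rewrite innerC inner_gamma.
have -> : ((P + invmx P) *m (invmx (Omega x) *m gamma i x))^T =
    row i (gamma_mx x) *m S x.
  by rewrite [_ *m (_ *m gamma i x)]mulmxA trmx_mul Ssym rowK.
by rewrite -!row_mul mxE.
Qed.

Lemma transform_f_dressed : transform_f f v P phi gamma Omega =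
  dressed_map P f (pair_e f v) phi_row gamma_mx Omega.
Proof.
apply/funext => x; rewrite /transform_f /dressed_map; congr (_ - _).
have -> : phi_row x *m (invmx (Omega x))^T = (invmx (Omega x) *m phi x)^T.
  by rewrite trmx_mul.
have -> : (invmx (Omega x) *m phi x)^T *m ((gamma_mx x)^T *m pair_e f v x
    + P^T *m ((gamma_mx x)^T *m pair_e f v x) *m Jmx R n) =
  (invmx (Omega x) *m phi x)^T *m (gamma_mx x)^T *m pair_e f v x
  + (P *m (invmx (Omega x) *m phi x))^T *m (gamma_mx x)^T
    *m (pair_e f v x *m Jmx R n).
  by rewrite [in RHS](trmx_mul P); mx_ring.
rewrite mulmx_sum_row [X in _ = _ + X]mulmx_sum_row -big_split.
by apply: eq_bigr => j _; rewrite /cscale /= !inner_gamma row_mul rowK.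
Qed.
End LinearSystem.

Theorem corollary47 (R : realType) (n d : nat)
    (U W : set 'rV[R]_n)
    (g : 'rV[R]_n -> 'M[R]_n)
    (f : 'rV[R]_n -> 'rV[R]_(n + n))
    (v : 'I_n -> 'rV[R]_n -> R)
    (h : 'I_n -> 'I_n -> 'rV[R]_n -> R)
    (P : 'M[R]_d)
    (phi : 'rV[R]_n -> 'cV[R]_d)
    (gamma : 'I_n -> 'rV[R]_n -> 'cV[R]_d)
    (Omega : 'rV[R]_n -> 'M[R]_d)
    (openU : open U)
    (f_isometric : isometric_immersion U g f)
    (g_flat : flat U g)
    (f_lagrangian : lagrangian U f)
    (f_nullity : forall x, U x -> relative_nullity f x = 0%N)
    (v_pos : forall i x, U x -> 0 < v i x)
    (vh_pair : associated_pair U g f v h)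
    (vh_system : solves_system U v h)
    (P_spectrum :
       spectrum P `&` [set - a | a in spectrum P] = set0)
    (openW : open W)
    (subWU : W `<=` U)
    (phi_gamma : solves_linear_system W v h P phi gamma)
    (Omega_unit : forall x, W x -> Omega x \in unitmx)
    (Omega_eq : forall x, W x ->
       P^T *m (Omega x)^T + (Omega x)^T *m P =
       (P^T *m P^T + 1%:M) *m (diff_mx phi x *m adj_diff_mx g phi x) *m P)
    (v'_neq0 : forall i x, W x -> transform_v v P phi gamma Omega i x != 0) :
  let f' := transform_f f v P phi gamma Omega in
  let v' := transform_v v P phi gamma Omega in
  let h' := transform_h h P gamma Omega in
  [/\ isometric_immersion W (induced_metric f') f',
      lagrangian W f',
      flat W (induced_metric f'),
      associated_pair W (induced_metric f') f' v' h'
    & solves_system W v' h'].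
Proof.
move=> f' v' h'.
have isoW : isometric_immersion W g f.
  have [[sg gp] [sf fi] fg] := f_isometric.
  split; [split | split |] => [|x /subWU Ux||x /subWU Ux|x /subWU Ux].
  - exact: subset_smooth sg.
  - exact: gp.
  - exact: subset_smooth sf.
  - exact: fi.
  - exact: fg.
have lagW : lagrangian W f by move=> x /subWU Ux; apply: f_lagrangian.
have pairW : associated_pair W g f v h.
  have [p1 p2 p3 p4] := vh_pair; split.
  - move=> i; have [sv v0] := p1 i; split; first exact: subset_smooth sv.
    by move=> x /subWU; apply: v0.
  - by move=> x /subWU; apply: p2.
  - by move=> i j x /subWU; apply: p3.
  - by move=> i j x /subWU; apply: p4.
have sysW : solves_system W v h.
  have [[s1 s2] s3 s4 s5] := vh_system; split.
  - split=> [i|i j ij]; first exact: subset_smooth (s1 i).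
    exact: subset_smooth (s2 i j ij).
  - by move=> i j x /subWU; apply: s3.
  - by move=> i j x /subWU; apply: s4.
  - by move=> i j l x /subWU; apply: s5.
have syl_inj := sylvester_inj P_spectrum.
have Pu := sylvester_unitmx P_spectrum.
have frE := pair_lagrangian_frame openW isoW lagW pairW sysW.
have sysE := pair_frame_system pairW sysW.
have sT := smooth_gamma_mx openW phi_gamma.
have OmE x : W x -> P^T *m (Omega x)^T + (Omega x)^T *m P =
    (P^T *m P^T + 1%:M) *m ((gamma_mx gamma x)^T *m gamma_mx gamma x) *m P.
  by move=> Wx; rewrite -(gram_diff pairW phi_gamma Wx) Omega_eq.
have sOm : smooth W Omega.
  have sC : smooth W (fun x => (P^T *m P^T + 1%:M)
      *m ((gamma_mx gamma x)^T *m gamma_mx gamma x) *m P).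
    apply: (smooth_mulmx openW _ (@smooth_cst _ _ W _ P)).
    apply: (smooth_mulmx openW (@smooth_cst _ _ W _ _)).
    by apply: smooth_mulmx => //; apply: smooth_trmx.
  have sY := sylvester_smooth P_spectrum openW OmE sC.
  by apply: eq_smooth (smooth_trmx openW sY) => // x _; rewrite trmxK.
have srho := smooth_phi_row openW phi_gamma.
have hrho := phi_row_partial openW phi_gamma.
have hT := gamma_mx_partial openW pairW phi_gamma.
have fr' := transform_lagrangian_frame openW frE syl_inj Pu Omega_unit OmE sOm srho
  sT hrho hT.
have sys' := transform_frame_system openW frE syl_inj Pu Omega_unit OmE sOm
  hrho hT sysE.
have Ssym x : W x -> ((P + invmx P) *m invmx (Omega x))^T =
    (P + invmx P) *m invmx (Omega x).
  move=> Wx; apply: dressing_sym (OmE x Wx) => //; first exact: Omega_unit.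
  by rewrite trmx_mul trmxK.
have vE i x : W x ->
    v' i x = dressed_v P (pair_v v) (phi_row phi) (gamma_mx gamma) Omega x 0 i.
  by move=> Wx; apply: transform_v_dressed; apply: Ssym.
have hE i j x : W x -> i != j ->
    h' i j x = dressed_h P (pair_h h) (gamma_mx gamma) Omega x i j.
  by move=> Wx ij; apply: transform_h_dressed => //; apply: Ssym.
have v0 i x : W x ->
    dressed_v P (pair_v v) (phi_row phi) (gamma_mx gamma) Omega x 0 i != 0.
  by move=> Wx; rewrite -vE //; apply: v'_neq0.
rewrite /f' transform_f_dressed; split.
- exact: lagrangian_frame_isometric fr' v0.
- exact: lagrangian_frame_lagrangian fr' v0.
- exact: lagrangian_frame_flat fr' v0 sys'.
- by apply: (lagrangian_frame_pair openW fr' v0 sys').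
- by apply: (lagrangian_frame_solves openW fr' sys').
Qed.
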